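(* Let $p$ be an odd prime, let $m\geq 3$ and $l$ be positive integers with $\gcd(m,l)=1$, let $q=p^m$, and let $\mathrm{Tr}$ denote the trace function from $\mathbb{F}_q$ onto $\mathbb{F}_p$. Fix an ordering of the elements of $\mathbb{F}_q$ and consider the linear code over $\mathbb{F}_p$ of length $p^m$ $$\mathcal{D}_2=\{(\mathrm{Tr}(ax^{p^l+1}+bx)+h)_{x\in\mathbb{F}_q} : a,b\in\mathbb{F}_q,\ h\in\mathbb{F}_p\}.$$ Then $\dim\mathcal{D}_2=2m+1$ and its weight distribution (weight: number of codewords of that weight) is as follows. If $m$ is odd: - $0$: $1$; - $p^{m-1}(p-1)$: $p(p^{m-1}+1)(p^m-1)$; - $p^{m-1}(p-1)+p^{\frac{m-1}{2}}$: $\frac{1}{2}p^m(p-1)(p^m-1)$; - $p^{m-1}(p-1)-p^{\frac{m-1}{2}}$: $\frac{1}{2}p^m(p-1)(p^m-1)$; - $p^m$: $p-1$. If $m$ is even: - $0$: $1$; - $p^{m-1}(p-1)$: $p(p^{m-1}-p^{m-2}+1)(p^m-1)$; - $p^{m-1}(p-1)-(-1)^{\frac{m}{2}}p^{\frac{m}{2}-1}(p-1)$: $p^{m+1}(p^m-1)/(p+1)$; - $p^{m-1}(p-1)+(-1)^{\frac{m}{2}}p^{\frac{m}{2}-1}$: $p^{m+1}(p-1)(p^m-1)/(p+1)$; - $p^{m-1}(p-1)+(-1)^{\frac{m}{2}}p^{\frac{m}{2}}(p-1)$: $p^{m-2}(p^m-1)/(p+1)$; - $p^{m-1}(p-1)-(-1)^{\frac{m}{2}}p^{\frac{m}{2}}$: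 $p^{m-2}(p-1)(p^m-1)/(p+1)$; - $p^m$: $p-1$.
   Context: In the paper this code is denoted $\overline{\mathcal{C}_2^{\perp}}^{\perp}$, where $\mathcal{C}_2$ is the cyclic code of length $p^m-1$ over $\mathbb{F}_p$ whose parity-check polynomial is the product of the minimal polynomials over $\mathbb{F}_p$ of $\alpha$ and $\alpha^{p^l+1}$ for a primitive element $\alpha$ of $\mathbb{F}_q$. The Hamming weight of a codeword is its number of nonzero coordinates. *)

(* Defs.v *)
From HB Require Import structures.
From mathcomp Require Import all_boot all_order all_algebra all_fingroup all_solvable all_field.

Set Implicit Arguments.
Unset Strict Implicit.
Unset Printing Implicit Defensive.

Import GRing.Theory.
Local Open Scope ring_scope.

(* [galTrace] takes its values in the line [1] of the extension field, so the
   trace onto ['F_p] is the unique scalar [c] such that [c%:A] is that value;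
   the default [0] is never used, see [trFpE] and [trFp_Frobenius]. *)
Definition trFp (p : nat) (F : finFieldType) (charF : p \in [pchar F]) (x : F) :
    'F_p :=
  odflt 0 [pick c : 'F_p |
    c%:A == galTrace 1%AS {:pPrimeCharType charF} (x : pPrimeCharType charF)].

Lemma trFpE (p : nat) (F : finFieldType) (charF : p \in [pchar F]) (x : F) :
  (trFp charF x)%:A =
  galTrace 1%AS {:pPrimeCharType charF} (x : pPrimeCharType charF).
Proof.
rewrite /trFp; case: pickP => [c /eqP // | no_c].
have /mem_galTrace -/(_ x (memvf _)) : galois 1%AS {:pPrimeCharType charF}.
  exact/finField_galois/sub1v.
by case/vlineP=> c Dc; have:= no_c c; rewrite Dc eqxx.
Qed.

Lemma trFp_Frobenius (p m : nat) (F : finFieldType) (charF : p \in [pchar F])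
    (x : F) : #|F| = (p ^ m)%N ->
  (trFp charF x : nat)%:R = \sum_(i < m) x ^+ (p ^ i) :> F.
Proof.
move=> oF; have p_pr := pcharf_prime charF.
have -> : (trFp charF x : nat)%:R = (trFp charF x)%:A :> pPrimeCharType charF.
  by rewrite -[RHS]/(_ * 1) mulr1.
rewrite trFpE /galTrace.
have [a /eqP genG Da] := finField_galois_generator (sub1v {:pPrimeCharType charF}).
have dimF : \dim {:pPrimeCharType charF} = m.
  by rewrite pprimeChar_dimf oF pfactorK.
have oa : #[a]%g = m.
  have := galois_dim (finField_galois (sub1v {:pPrimeCharType charF})).
  by rewrite dimv1 divn1 dimF genG => ->.
have Dai i : (a ^+ i)%g x = x ^+ (p ^ i).
  elim: i => [|i IHi]; first by rewrite gal_id.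
  by rewrite expgSr galM ?memvf // IHi Da ?memvf // dimv1 expn1 card_Fp //
             -exprM -expnSr.
rewrite genG -[in RHS]oa.
have -> : <[a]>%g = [set (a ^+ val i)%g | i in [set: 'I_#[a]%g]].
  apply/setP=> b; apply/idP/imsetP=> [/cyclePmin[i lt_i ->] | [i _ ->]].
    by exists (Ordinal lt_i); rewrite ?inE.
  exact: mem_cycle.
rewrite big_imset /= => [|i j _ _ /eqP].
  by under eq_bigl do rewrite inE; apply: eq_bigr => i _; apply: Dai.
by rewrite eq_expg_mod_order !modn_small // => /eqP/val_inj.
Qed.

Definition hamming_weight (R : nmodType) (n : nat) (c : 'rV[R]_n) : nat :=
  #|[set i | c 0 i != 0]|.

Definition has_weight_distribution (R : finNmodType) (n : nat)
    (C : {set 'rV[R]_n}) (table : seq (rat * rat)) : Prop :=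
  (forall r, r \in table ->
     #|[set c in C | (hamming_weight c)%:R == r.1]|%:R = r.2)
  /\ (forall c, c \in C -> (hamming_weight c)%:R \in unzip1 table).

Definition linear_code_of_dim (K : finFieldType) (n : nat)
    (C : {set 'rV[K]_n}) (k : nat) : Prop :=
  exists2 V : {vspace 'rV[K]_n}, V =i C & \dim V = k.

(* [e] is the fixed ordering of the elements of the field. *)
Definition code_D2 (p : nat) (F : finFieldType) (charF : p \in [pchar F])
    (n : nat) (e : 'I_n -> F) (l : nat) : {set 'rV['F_p]_n} :=
  [set c | [exists a : F, exists b : F, exists h : 'F_p,
     c == \row_i (trFp charF (a * e i ^+ (p ^ l + 1) + b * e i) + h)]].

(* Main.v *)
(** All sums over additive characters are replaced by counting.  Write
    Q_a(x) = Tr(a x^(p^l+1)), a quadratic form over F_p with radical of size r,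
    and N_c = #{x | Q_a(x) = c}.  Completing the square shows that for fixed a
    the number of zeros of Tr(a x^(p^l+1) + b x) + h is some N_c when the linear
    form Tr(b x) vanishes on the radical (each c arising q/r times from the
    pairs (b, h)) and q/p otherwise.  So only the N_c are needed, and they are
    pinned down by their second moment p sum_c N_c^2 = q^2 + (p-1) q r together
    with homogeneity in c.

    For odd m the radical is trivial and x^(p^l+1) runs over the squares, each
    class of F^* modulo squares being represented in F_p; hence
    N_c + N_(gc) = 2q/p for a nonsquare g of F_p, and N_c - q/p is 0 at c = 0
    and one of the two square roots of q/p elsewhere.

    For even m every element of F_p^* is a (p^l+1)-th power, so N_c = N_1 for
    c <> 0 and T = N_0 - N_1 satisfies T^2 = q r with r = 1 or r = p^2.  The
    fibers of x^(p^l+1) on F^* have p+1 elements, so T = 1 mod p+1, which fixes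
    the sign of T.  The number of a with r = p^2 then follows from
    sum_(a <> 0) T(a) = 0. *)

From HB Require Import structures.
Require Import Defs.
From mathcomp Require Import all_boot all_order all_algebra all_fingroup.
From mathcomp Require Import all_solvable all_field.
From mathcomp Require Import ring lra zify.
Set Implicit Arguments.
Unset Strict Implicit.
Unset Printing Implicit Defensive.
Import Order.TTheory GRing.Theory Num.Theory.
Local Open Scope ring_scope.

(** * Embedding of the prime field *)

Section PrimeFieldEmbedding.

Variables (p : nat) (F : finFieldType).

(** Written through the natural representative to match [trFp_Frobenius]; [embE] identifies it with
    the scalar embedding, from which the morphism laws come. *)
Definition emb (charF : p \in [pchar F]) (t : 'F_p) : F := (t : nat)%:R.

Variable charF : p \in [pchar F].

Lemma embE t : emb charF t = in_alg (pPrimeCharType charF) t.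
Proof. by rewrite -[RHS]/(_ * 1) mulr1. Qed.

Fact emb_additive : additive (emb charF).
Proof. by move=> s t; rewrite !embE rmorphB. Qed.

Fact emb_monoid_morphism : monoid_morphism (emb charF).
Proof. by split=> [|s t]; rewrite !embE ?rmorph1 ?rmorphM. Qed.

HB.instance Definition _ :=
  GRing.isZmodMorphism.Build 'F_p F (emb charF) emb_additive.
HB.instance Definition _ :=
  GRing.isMonoidMorphism.Build 'F_p F (emb charF) emb_monoid_morphism.

End PrimeFieldEmbedding.

(** * Cyclicity of the multiplicative group and images of power maps *)

Lemma card_finField_pred_gt0 (F : finFieldType) : (0 < #|F|.-1)%N.
Proof. by have := finNzRing_gt1 F; case: #|F| => [|[]]. Qed.

Lemma expf_pred_card (F : finFieldType) (x : F) : x != 0 -> x ^+ #|F|.-1 = 1.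
Proof.
move=> nz_x; apply: (mulfI nz_x).
by rewrite -exprS mulr1 prednK ?expf_card // (ltnW (finNzRing_gt1 F)).
Qed.

Lemma finField_prim_root (F : finFieldType) :
  {w : F | (#|F|.-1).-primitive_root w}.
Proof.
have: has (#|F|.-1).-primitive_root (enum (predC1 (0 : F))).
  apply: has_prim_root; rewrite ?enum_uniq ?card_finField_pred_gt0 //.
    apply/allP => x; rewrite mem_enum inE => nz_x.
    by rewrite unity_rootE expf_pred_card.
  by rewrite -cardE cardC1.
move/hasP=> ex_w.
case: (pickP [pred w : F | (#|F|.-1).-primitive_root w]) => [w pw | no_w].
  by exists w.
by exfalso; have [w _] := ex_w; have /= -> := no_w w.
Qed.

(** With w a generator and k = (q-1)/n, these roots are the n distinct powers of w^k. *)
Lemma finField_unity_roots (F : finFieldType) n :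
  (n %| #|F|.-1)%N -> #|[set x : F | x ^+ n == 1]| = n.
Proof.
move=> dvn; have q_gt0 := card_finField_pred_gt0 F.
have n_gt0 := dvdn_gt0 q_gt0 dvn.
have [w pw] := finField_prim_root F; have [k Dk] := dvdnP dvn.
have k_gt0 : (0 < k)%N by move: q_gt0; rewrite Dk; case: (k).
have pz : n.-primitive_root (w ^+ k).
  have := exp_prim_root pw k.
  have -> // : (#|F|.-1 %/ gcdn k #|F|.-1 = n)%N.
  by rewrite Dk gcdnMr mulKn.
have -> : [set x : F | x ^+ n == 1] = [set (w ^+ k) ^+ val i | i in [set: 'I_n]].
  apply/setP=> x; rewrite !inE; apply/eqP/imsetP => [xn1|[i _ ->]].
    by have [i Di] := prim_rootP pz xn1; exists i.
  by rewrite -exprM mulnC exprM (prim_expr_order pz) expr1n.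
rewrite card_imset ?cardsT ?card_ord // => i j /eqP.
by rewrite (eq_prim_root_expr pz) !modn_small ?ltn_ord // => /eqP/val_inj.
Qed.

(** For a generator w, the d-th powers are the powers of w^gcd(d, q-1). The hypothesis on roots of
    unity forces gcd(d, q-1) to divide n, and the last equation makes v a power of w^n. Only roots
    of unity have to be computed in applications, not the gcd. *)
Lemma finField_exp_image (F : finFieldType) (d n : nat) (v : F) :
    (n %| #|F|.-1)%N -> (0 < d)%N -> (forall x : F, x ^+ d = 1 -> x ^+ n = 1) ->
  v ^+ (#|F|.-1 %/ n) = 1 -> exists x : F, v = x ^+ d.
Proof.
have q_gt0 := card_finField_pred_gt0 F; move=> dv_n_q d_gt0 d_n v1.
have n_gt0 := dvdn_gt0 q_gt0 dv_n_q.
have k_gt0 : (0 < #|F|.-1 %/ n)%N by rewrite divn_gt0 // dvdn_leq.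
have [w pw] := finField_prim_root F.
have nz_v : v != 0.
  by apply: contra_eq_neq v1 => ->; rewrite expr0n eqn0Ngt k_gt0 eq_sym oner_neq0.
have [[j lt_j] /= Dv] := prim_rootP pw (expf_pred_card nz_v).
have dv_n_j : (n %| j)%N.
  move/eqP: v1; rewrite Dv -exprM -(prim_order_dvd pw).
  by rewrite -{1}(divnK dv_n_q) mulnC dvdn_pmul2r.
have dv_g : (gcdn d #|F|.-1 %| n)%N.
  move: (dvdn_gcdl d #|F|.-1) (dvdn_gcdr d #|F|.-1).
  move: (gcdn d #|F|.-1) => g /dvdnP[kd Dd] /dvdnP[kq Dq].
  (* The order of w^kq is exactly g, so it is the root of unity on which the hypothesis says
     most. *)
  have /d_n/eqP : (w ^+ kq) ^+ d = 1.
    apply/eqP; rewrite -exprM -(prim_order_dvd pw) Dq Dd.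
    by rewrite mulnCA dvdn_mull.
  rewrite -exprM -(prim_order_dvd pw) Dq dvdn_pmul2l //.
  by move: q_gt0; rewrite Dq; case: (kq).
have /dvdnP[k Dk] := dvdn_trans dv_g dv_n_j.
(* Bezout: a d = b (q-1) + gcd(d, q-1), so the d-th power of w^(k a) is w^j. *)
have [a b Dab _] := egcdnP #|F|.-1 d_gt0.
exists (w ^+ (k * a)); rewrite -exprM -mulnA Dab mulnDr -Dk exprD -Dv.
by rewrite mulnA mulnC exprM (prim_expr_order pw) expr1n mul1r.
Qed.

Definition nsol (T : finType) (U : eqType) (f : T -> U) (c : U) : nat :=
  #|[set x | f x == c]|.

(** * The trace and its equidistribution *)

Section Trace.

Variables (p m : nat) (F : finFieldType) (charF : p \in [pchar F]).
Hypothesis oF : #|F| = (p ^ m)%N.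

Let p_pr : prime p := pcharf_prime charF.
Local Notation tr := (trFp charF).
Local Notation emb := (emb charF).

Lemma tr_sum (x : F) : emb (tr x) = \sum_(i < m) x ^+ (p ^ i).
Proof. exact: trFp_Frobenius oF. Qed.

Lemma exprD_pchar_pow (x y : F) k :
  (x + y) ^+ (p ^ k) = x ^+ (p ^ k) + y ^+ (p ^ k).
Proof.
by apply: exprDn_pchar; rewrite pnatX (eq_pnat _ (pcharf_eq charF)) pnat_id.
Qed.

Lemma expr_card_iter (x : F) k : x ^+ (p ^ (m * k)) = x.
Proof.
elim: k => [|k IHk]; first by rewrite muln0 expr1.
by rewrite mulnS expnD exprM -oF expf_card.
Qed.

Lemma emb_exp (t : 'F_p) k : emb t ^+ (p ^ k) = emb t.
Proof.
elim: k => [|k IHk] //; rewrite expnS exprM -rmorphXn /=.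
by rewrite -[X in t ^+ X](card_Fp p_pr) expf_card.
Qed.

Lemma trD : {morph tr : x y / x + y}.
Proof.
move=> x y; apply: (fmorph_inj emb); rewrite rmorphD /= !tr_sum -big_split /=.
by apply: eq_bigr => i _; apply: exprD_pchar_pow.
Qed.

Lemma trZ t x : tr (emb t * x) = t * tr x.
Proof.
apply: (fmorph_inj emb); rewrite rmorphM /= !tr_sum mulr_sumr.
by apply: eq_bigr => i _; rewrite exprMn emb_exp.
Qed.

Lemma tr0 : tr 0 = 0.
Proof. by have := trZ 0 0; rewrite mulr0 mul0r. Qed.

Lemma card_exp_gt0 : (0 < m)%N.
Proof. by have := finNzRing_gt1 F; rewrite oF; case: (m). Qed.

(** Raising to the power p permutes the summands of the trace cyclically, because x^(p^m) = x. *)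
Lemma tr_Frobenius k x : tr (x ^+ (p ^ k)) = tr x.
Proof.
elim: k x => [|k IHk] x; first by rewrite expr1.
rewrite expnS exprM IHk; apply: (fmorph_inj emb); rewrite /= !tr_sum.
case: (m) card_exp_gt0 oF => // n _ oFn.
rewrite big_ord_recr big_ord_recl /= addrC expn0 expr1.
rewrite -exprM -expnS -oFn expf_card; congr (_ + _).
by apply: eq_bigr => i _; rewrite -exprM -expnS.
Qed.

(** By linearity one nonzero value suffices. If there were none, all p^m elements would be roots of
    a nonzero polynomial of degree at most p^(m-1). *)
Lemma tr_onto (c : 'F_p) : exists x, tr x = c.
Proof.
suff [x nz_x] : exists x, tr x != 0.
  by exists (emb (c / tr x) * x); rewrite trZ divfK.
apply/existsP; apply: contraT; rewrite negb_exists => /forallP tr_eq0.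
pose g : {poly F} := \sum_(i < m) 'X^(p ^ i).
have p1 := prime_gt1 p_pr.
have nz_g : g != 0.
  apply/eqP => /(congr1 (fun g : {poly F} => g`_1)); rewrite coef0 coef_sum.
  case: (m) card_exp_gt0 => // n _; rewrite big_ord_recl coefXn /= big1 ?addr0.
    by move/eqP; rewrite oner_eq0.
  by move=> i _; rewrite coefXn /bump /= -[X in (X == _)%N](expn0 p) eqn_exp2l.
have: all (root g) (enum F).
  apply/allP=> x _; rewrite rootE horner_sum; under eq_bigr do rewrite hornerXn.
  by rewrite -tr_sum (eqP (negbNE (tr_eq0 x))) rmorph0.
move/(max_poly_roots nz_g)/(_ (enum_uniq _)); rewrite -cardE oF.
have sz_g : (size g <= (p ^ m.-1).+1)%N.
  apply: leq_trans (size_sum _ _ _) _; apply/bigmax_leqP=> i _.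
  by rewrite size_polyXn ltnS leq_exp2l // -ltnS prednK // card_exp_gt0.
move/leq_trans/(_ sz_g); rewrite ltnS leq_exp2l // => le_m.
by move: le_m; case: (m) card_exp_gt0 => //= n _; rewrite ltnn.
Qed.

(** Translations by multiples of y preserve A and shift f by any prescribed scalar, so they map each
    level set injectively into any other. It is applied both to the whole field and to the
    radical. *)
Lemma card_equidistributed (A : {set F}) (f : F -> 'F_p) (y : F) (d : 'F_p) :
    d != 0 -> (forall x t, x \in A -> x + emb t * y \in A) ->
    (forall x t, x \in A -> f (x + emb t * y) = f x + t * d) ->
  forall c, (p * #|[set x in A | f x == c]|)%N = #|A|.
Proof.
move=> nz_d A_stable f_shift c.
have Ec c' : #|[set x in A | f x == c']| = #|[set x in A | f x == c]|.
  suff le_card c1 c2 :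
      (#|[set x in A | f x == c1]| <= #|[set x in A | f x == c2]|)%N.
    by apply/eqP; rewrite eqn_leq !le_card.
  rewrite -(card_imset _ (addIr (emb ((c2 - c1) / d) * y))).
  apply/subset_leq_card/subsetP=> _ /imsetP[x /[!inE]/andP[Ax /eqP fx] ->].
  by rewrite A_stable //= f_shift // fx divfK // addrC subrK.
rewrite -[RHS]sum1_card (partition_big f predT) //=.
rewrite (eq_bigr (fun _ => #|[set x in A | f x == c]|)) => [|c' _].
  by rewrite sum_nat_const card_Fp.
by rewrite -(Ec c') -sum1_card; apply: eq_bigl => x; rewrite inE.
Qed.

Lemma nsol_tr (b : F) c :
  b != 0 -> (p * nsol (fun x => (tr (b * x))%R) c)%N = (p ^ m)%N.
Proof.
move=> nz_b; have [z tr_z] := tr_onto 1.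
rewrite -oF -cardsT.
rewrite -(@card_equidistributed setT (fun x => tr (b * x)) (z / b) 1 _ _ _ c).
- by congr (p * _)%N; apply: eq_card => x; rewrite !inE.
- exact: oner_neq0.
- by move=> x t _; rewrite inE.
move=> x t _; rewrite mulrDr trD mulrCA trZ [b * (z / b)]mulrC divfK //.
by rewrite tr_z mulr1.
Qed.

End Trace.

(** * Elementary counting identities *)

Lemma nsol_sum (T : finType) (U : eqType) (f : T -> U) c :
  nsol f c = (\sum_x (f x == c))%N.
Proof. by rewrite /nsol -sum1dep_card big_mkcond. Qed.

(** Both sides count the pairs (x, y) on which f agrees. *)
Lemma sum_nsol_sqr (T U : finType) (f : T -> U) :
  (\sum_c nsol f c ^ 2 = \sum_x \sum_y (f y == f x))%N.
Proof.
rewrite [RHS](partition_big f predT) //=; apply: eq_bigr => c _.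
rewrite (eq_bigr (fun _ => nsol f c)) => [|x /eqP->]; last by rewrite nsol_sum.
by rewrite sum_nat_const -mulnn; congr (_ * _)%N; apply: eq_card => x; rewrite inE.
Qed.

Lemma sum_notin_const (T : finType) (A : {set T}) k :
  (\sum_(x | x \notin A) k = (#|T| - #|A|) * k)%N.
Proof.
rewrite -(cardsC A) addKn -sum_nat_const; apply: eq_bigl => x.
by rewrite !inE.
Qed.

(** * The quadratic form, its radical, and completing the square *)

Section QuadraticForm.

Variables (p m l : nat) (F : finFieldType) (charF : p \in [pchar F]).
Hypothesis (oF : #|F| = (p ^ m)%N) (odd_p : odd p).

Let p_pr : prime p := pcharf_prime charF.
Let p_gt1 : (1 < p)%N := prime_gt1 p_pr.
Let m_gt0 : (0 < m)%N := card_exp_gt0 oF.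
Local Notation tr := (trFp charF).
Local Notation emb := (emb charF).

Definition quad (a x : F) : 'F_p := tr (a * x ^+ (p ^ l + 1)).

(* The summand [(a * z) ^+ (p ^ (l * (m - 1)))] is the [p ^ l]-th root of
   [a * z], so [polar a] is the adjoint map of the polar form of [quad a]. *)
Definition polar (a z : F) : F :=
  (a * z) ^+ (p ^ (l * (m - 1))) + a * z ^+ (p ^ l).

Definition radical (a : F) : {set F} := [set z | polar a z == 0].

(** The cross term a z x^(p^l) is made linear in x inside the trace: l Frobenius steps turn the
    first summand of [polar a z] times x into it, since l (m-1) + l = m l steps fix F. *)
Lemma quadD a x z : quad a (x + z) = quad a x + quad a z + tr (polar a z * x).
Proof.
rewrite /quad /polar !addn1 !exprS exprD_pchar_pow // [in RHS]mulrDl (trD charF oF).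
have -> : tr ((a * z) ^+ (p ^ (l * (m - 1))) * x) = tr (a * z * x ^+ (p ^ l)).
  rewrite -[LHS](tr_Frobenius charF oF l) exprMn -exprM -expnD.
  have -> : (l * (m - 1) + l = m * l)%N by rewrite mulnC -mulSnr subn1 prednK.
  by rewrite (expr_card_iter oF).
by rewrite -!(trD charF oF); congr (tr _); ring.
Qed.

Lemma polarD a : {morph polar a : x y / x + y}.
Proof. by move=> x y; rewrite /polar mulrDr !exprD_pchar_pow // mulrDr addrACA. Qed.

Lemma polarZ a t z : polar a (emb t * z) = emb t * polar a z.
Proof.
rewrite /polar mulrCA ![(emb t * _) ^+ _]exprMn !emb_exp.
by rewrite [a * (_ * _)]mulrCA mulrDr.
Qed.

Lemma polar0 a : polar a 0 = 0.
Proof. by have := polarZ a 0 0; rewrite mulr0 rmorph0 mul0r. Qed.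

Lemma polarN a z : polar a (- z) = - polar a z.
Proof. by apply/eqP; rewrite -addr_eq0 -polarD addNr polar0. Qed.

Lemma tr_polarC a x y : tr (polar a x * y) = tr (polar a y * x).
Proof.
have := quadD a x y; rewrite addrC quadD [quad a y + _]addrC.
by move/addrI.
Qed.

Lemma quad0 a : quad a 0 = 0.
Proof. by rewrite /quad addn1 exprS mul0r mulr0 (tr0 charF oF). Qed.

Lemma quadN a x : quad a (- x) = quad a x.
Proof. by rewrite /quad exprNn -signr_odd oddD oddX odd_p orbT mul1r. Qed.

(** For z in the radical, 0 = Q(-z + z) = 2 Q(z), and p is odd. *)
Lemma quad_radical a z : z \in radical a -> quad a z = 0.
Proof.
rewrite inE => /eqP Lz; have := quadD a (- z) z.
rewrite addNr quad0 quadN Lz mul0r (tr0 charF oF) addr0 => /esym/eqP.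
rewrite -mulr2n -mulr_natl mulf_eq0 -(dvdn_pcharf (pchar_Fp p_pr)).
case/orP=> [/dvdn_leq-/(_ isT) | /eqP //].
by rewrite leqNgt odd_prime_gt2.
Qed.

Lemma radical0 a : 0 \in radical a.
Proof. by rewrite inE polar0. Qed.

(** Count the pairs x, x + z with equal values. The condition is linear in x: it holds for all x
    when z is in the radical and for q/p values of x otherwise. The term -q r is moved to the left
    to avoid truncated subtraction. *)
Lemma sum_nsol_quad_sqr a :
  (p * \sum_c nsol (quad a) c ^ 2 + p ^ m * #|radical a| =
     p ^ m * p ^ m + p * p ^ m * #|radical a|)%N.
Proof.
have -> : (\sum_c nsol (quad a) c ^ 2 =
    \sum_z nsol (fun x => tr (polar a z * x)%R) (- quad a z)%R)%N.
  rewrite sum_nsol_sqr.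
  under eq_bigr => x _ do rewrite (reindex_inj (addrI x)).
  rewrite exchange_big; apply: eq_bigr => z _; rewrite nsol_sum.
  apply: eq_bigr => x _; rewrite quadD -addrA addrC -subr_eq0 addrK addrC.
  by rewrite addr_eq0.
rewrite big_distrr (bigID (mem (radical a))) /=.
rewrite (eq_bigr (fun _ => p * p ^ m)%N) => [|z rad_z]; last first.
  congr (_ * _)%N; rewrite -oF -cardsT; apply: eq_card => x.
  move: (rad_z); rewrite !inE => /eqP->; rewrite quad_radical //.
  by rewrite mul0r (tr0 charF oF) oppr0 eqxx.
rewrite [X in (_ + X + _)%N](eq_bigr (fun _ => p ^ m)%N) => [|z]; last first.
  by rewrite inE => nz; rewrite (nsol_tr charF oF).
rewrite sum_notin_const sum_nat_const oF.
have : (#|radical a| <= p ^ m)%N by rewrite -oF max_card.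
by move: (p ^ m)%N #|radical a| => q r; nia.
Qed.

(** The fibers of the additive map [polar a] are cosets of the radical. *)
Lemma sum_polar_fibers a (G : F -> nat) :
  (#|radical a| * \sum_(b in [set polar a x | x in F]) G b =
     \sum_x G (polar a x))%N.
Proof.
rewrite [RHS](partition_big_imset (polar a)) big_distrr /=.
apply: eq_bigr => _ /imsetP[x0 _ ->].
rewrite (eq_bigr (fun _ => G (polar a x0))) => [|x /eqP-> //].
rewrite sum_nat_const; congr (_ * _)%N.
rewrite -(card_imset _ (addIr x0)); apply: eq_card => x.
apply/imsetP/eqP => [[z rad_z ->]|Lx].
  by move: rad_z; rewrite inE polarD => /eqP->; rewrite add0r.
by exists (x - x0); rewrite ?subrK // inE polarD polarN Lx subrr.
Qed.

Lemma card_polar_image a : (#|radical a| * #|[set polar a x | x in F]| = p ^ m)%N.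
Proof. by have := sum_polar_fibers a (fun=> 1%N); rewrite !sum1_card oF. Qed.

Definition radical_perp a : {set F} :=
  [set b | [forall z in radical a, tr (b * z) == 0]].

(** Double count of the pairs (b, z) with z in the radical and tr(b z) = 0: a fixed b admits the
    whole radical or one p-th of it, and a fixed nonzero z admits q/p values of b. *)
Lemma card_radical_perp a : (#|radical a| * #|radical_perp a| = p ^ m)%N.
Proof.
pose S := (\sum_b #|[set z in radical a | (tr (b * z) == 0)%R]|)%N.
have S1 : (p * S = #|radical_perp a| * (p * #|radical a|) +
    (p ^ m - #|radical_perp a|) * #|radical a|)%N.
  rewrite /S big_distrr (bigID (mem (radical_perp a))) /=.
  rewrite (eq_bigr (fun _ => p * #|radical a|)%N) => [|b]; last first.
    rewrite inE => /forall_inP perp_b; congr (_ * _)%N; apply: eq_card => z.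
    by rewrite inE andb_idr // => /perp_b.
  rewrite [X in (_ + X)%N](eq_bigr (fun _ => #|radical a|)) => [|b]; last first.
    rewrite inE negb_forall_in => /exists_inP[y rad_y nz_y].
    apply: (card_equidistributed nz_y (y := y)) => [x t|x t _].
      rewrite !inE polarD polarZ => /eqP->; move: rad_y; rewrite inE => /eqP->.
      by rewrite mulr0 addr0.
    by rewrite mulrDr (trD charF oF) mulrCA (trZ charF oF).
  by rewrite sum_notin_const sum_nat_const oF.
have S2 : (p * S = p * p ^ m + (#|radical a| - 1) * p ^ m)%N.
  have -> : (S = \sum_(z in radical a) nsol (fun b => tr (z * b)%R) 0%R)%N.
    rewrite /S; under eq_bigr => b _ do
      rewrite -sum1dep_card big_mkcondr.
    rewrite exchange_big; apply: eq_bigr => z _; rewrite nsol_sum.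
    by apply: eq_bigr => b _; rewrite mulrC; case: eqP.
  rewrite big_distrr (bigD1 0) ?radical0 //=; congr (_ + _)%N.
    congr (_ * _)%N; rewrite -oF -cardsT; apply: eq_card => b.
    by rewrite !inE mul0r (tr0 charF oF) eqxx.
  rewrite (eq_bigr (fun _ => p ^ m)%N) => [|z /andP[_ nz_z]]; last first.
    by rewrite (nsol_tr charF oF).
  rewrite sum_nat_const; congr (_ * _)%N.
  rewrite (cardsD1 0 (radical a)) radical0 add1n subn1 /=.
  by apply: eq_card => z; rewrite in_setD1 andbC.
have r_gt0 : (0 < #|radical a|)%N by apply/card_gt0P; exists 0; apply: radical0.
have le_perp : (#|radical_perp a| <= p ^ m)%N by rewrite -oF max_card.
move: S2; rewrite S1; move: le_perp r_gt0 p_gt1.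
move: #|radical_perp a| #|radical a| (p ^ m)%N => P r q le_P r_gt0 p1 E.
have : ((p - 1) * (r * P) = (p - 1) * q)%N by nia.
by move/eqP; rewrite eqn_pmul2l ?subn_gt0 // => /eqP.
Qed.

(** Symmetry of the polar form gives one inclusion; both sets have q/r elements. *)
Lemma polar_imageE a : [set polar a x | x in F] = radical_perp a.
Proof.
apply/eqP; rewrite eqEcard; apply/andP; split.
  apply/subsetP=> _ /imsetP[x _ ->]; rewrite inE; apply/forall_inP=> z.
  by rewrite inE tr_polarC => /eqP->; rewrite mul0r (tr0 charF oF).
have r_gt0 : (0 < #|radical a|)%N by apply/card_gt0P; exists 0; apply: radical0.
by rewrite -(leq_pmul2l r_gt0) card_polar_image card_radical_perp.
Qed.

Definition word (a b : F) (h : 'F_p) (x : F) : 'F_p :=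
  tr (a * x ^+ (p ^ l + 1) + b * x) + h.

Lemma wordE a b h x : word a b h x = quad a x + tr (b * x) + h.
Proof. by rewrite /word (trD charF oF). Qed.

(** Completing the square: the substitution of x + x0 for x absorbs the linear term. *)
Lemma nsol_word_polar a x0 h :
  nsol (word a (polar a x0) h) 0 = nsol (quad a) (quad a x0 - h).
Proof.
rewrite !nsol_sum [RHS](reindex_inj (addIr x0)); apply: eq_bigr => x _.
rewrite wordE quadD -[in RHS]subr_eq0; congr (nat_of_bool (_ == 0)).
by ring.
Qed.

(** Some radical vector y has tr(b y) nonzero. Along y the quadratic part is constant, so the word
    changes only through its linear part. *)
Lemma nsol_word_equidistributed a b h :
  b \notin [set polar a x | x in F] -> nsol (word a b h) 0 = (p ^ (m - 1))%N.
Proof.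
rewrite polar_imageE inE negb_forall_in => /exists_inP[y rad_y nz_y].
apply/eqP; rewrite -(eqn_pmul2l (prime_gt0 p_pr)) -expnS subn1 prednK //.
rewrite -oF -cardsT.
rewrite -(card_equidistributed nz_y (f := word a b h) (A := setT) (y := y) _ _ 0).
- by rewrite /nsol; apply/eqP; congr (_ * _)%N; apply: eq_card => x; rewrite !inE.
- by move=> x t _; rewrite inE.
move=> x t _; have rad_ty : emb t * y \in radical a.
  by move: rad_y; rewrite !inE polarZ => /eqP->; rewrite mulr0.
rewrite !wordE quadD (quad_radical rad_ty); move: rad_ty; rewrite inE => /eqP->.
rewrite mul0r (tr0 charF oF) mulrDr (trD charF oF) mulrCA (trZ charF oF).
by ring.
Qed.

(** An arbitrary predicate B on the number of zeros treats all frequencies at once. The factor r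
    counts the fibers of [polar a] over its image, where the square is completed; the last term
    collects the b outside the image. *)
Lemma sum_word_pred a (B : pred nat) :
  (#|radical a| * \sum_b \sum_h B (nsol (word a b h) 0%R) =
     p ^ m * \sum_c B (nsol (quad a) c)
     + (p ^ m * #|radical a| - p ^ m) * p * B (p ^ (m - 1)))%N.
Proof.
rewrite (bigID (mem [set polar a x | x in F])) /= mulnDr sum_polar_fibers.
congr (_ + _)%N.
  rewrite -oF -sum_nat_const; apply: eq_big => // x0 _.
  rewrite [RHS](reindex_inj (can_inj (subKr (quad a x0)))).
  by apply: eq_bigr => h _; rewrite nsol_word_polar.
rewrite (eq_bigr (fun _ => p * B (p ^ (m - 1)))%N) => [|b b_im]; last first.
  under eq_bigr do rewrite nsol_word_equidistributed //.
  by rewrite sum_nat_const card_Fp.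
rewrite sum_notin_const oF !mulnA; congr (_ * _ * _)%N.
by rewrite mulnBr card_polar_image mulnC.
Qed.

End QuadraticForm.

Lemma card_Fp_neq0 p : prime p -> #|(fun c : 'F_p => c != 0)| = p.-1.
Proof.
by move=> p_pr; rewrite -[in RHS](card_Fp p_pr) -(cardC1 (0 : 'F_p)).
Qed.

Lemma natr_pred_prime p : prime p -> p.-1%:R = p%:R - 1 :> rat.
Proof.
by move=> p_pr; rewrite -[in RHS](prednK (prime_gt0 p_pr)) -natr1 addrK.
Qed.

(** * Symmetries and moments of the value counts *)

Section ValueCounts.

Variables (p m l : nat) (F : finFieldType) (charF : p \in [pchar F]).
Hypothesis (oF : #|F| = (p ^ m)%N) (odd_p : odd p) (l_gt0 : (0 < l)%N).

Let p_pr : prime p := pcharf_prime charF.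
Let p_gt1 : (1 < p)%N := prime_gt1 p_pr.
Let m_gt0 : (0 < m)%N := card_exp_gt0 oF.
Local Notation tr := (trFp charF).
Local Notation emb := (emb charF).
Local Notation Q := (quad l charF).
Local Notation Rad := (@radical p m l F).

Lemma natr2_neq0 : 2%:R != 0 :> F.
Proof.
rewrite -(dvdn_pcharf charF); apply/negP => /dvdn_leq-/(_ isT).
by rewrite leqNgt odd_prime_gt2.
Qed.

Lemma eqf_oppr (u : F) : u = - u -> u = 0.
Proof.
move/eqP; rewrite -addr_eq0 -mulr2n -mulr_natl mulf_eq0 (negPf natr2_neq0).
by move/eqP.
Qed.

Lemma exprN_pow (u : F) k : (- u) ^+ (p ^ k) = - u ^+ (p ^ k).
Proof. by rewrite exprNn -signr_odd oddX odd_p orbT expr1 mulN1r. Qed.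

(** Bezout on Frobenius exponents: u is fixed by the k-th and the m-th iterates. *)
Lemma expr_pow_fixed_gcd (u : F) k :
  (0 < k)%N -> u ^+ (p ^ k) = u -> u ^+ (p ^ gcdn k m) = u.
Proof.
move=> k_gt0 u_k; have [a b Dab _] := egcdnP m k_gt0.
have u_ka j : u ^+ (p ^ (j * k)) = u.
  by elim: j => [|j IHj]; rewrite ?expr1 // mulSn expnD exprM u_k.
by rewrite -[RHS](u_ka a) Dab mulnC expnD exprM (expr_card_iter oF).
Qed.

(** With u = a z^(p^l+1), the p^l-th power of [polar a z] times z^(p^l) equals u + u^(p^l). *)
Lemma in_radical (a z : F) : a != 0 -> z != 0 ->
  (z \in Rad a) =
    ((a * z ^+ (p ^ l + 1)) ^+ (p ^ l) == - (a * z ^+ (p ^ l + 1))).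
Proof.
move=> nz_a nz_z; rewrite inE.
have P_gt0 : (0 < p ^ l)%N by rewrite expn_gt0 prime_gt0.
transitivity (z ^+ (p ^ l) * polar p m l a z ^+ (p ^ l) == 0).
  by rewrite mulf_eq0 !expf_eq0 (negPf nz_z) P_gt0 andbF.
rewrite -addr_eq0 /polar exprD_pchar_pow //.
rewrite -[_ ^+ (p ^ (l * _)) ^+ _]exprM -expnD.
have -> : (l * (m - 1) + l = m * l)%N by rewrite mulnC -mulSnr subn1 prednK.
rewrite (expr_card_iter oF); congr (_ == 0).
rewrite !exprMn -![(z ^+ _) ^+ _]exprM mulnDl mul1n exprD addn1 exprS.
by ring.
Qed.

Lemma nsol_quad_exp (a y : F) c : y != 0 ->
  nsol (Q (a * y ^+ (p ^ l + 1))) c = nsol (Q a) c.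
Proof.
move=> nz_y; rewrite !nsol_sum [RHS](reindex_inj (mulfI nz_y)).
by apply: eq_bigr => x _; rewrite /quad exprMn mulrA.
Qed.

Lemma nsol_quad_emb (a : F) (t c : 'F_p) : t != 0 ->
  nsol (Q (emb t * a)) (t * c) = nsol (Q a) c.
Proof.
move=> nz_t; rewrite !nsol_sum; apply: eq_bigr => x _.
by rewrite /quad -mulrA (trZ charF oF) (inj_eq (mulfI nz_t)).
Qed.

Lemma emb_eq0 (t : 'F_p) : (emb t == 0) = (t == 0).
Proof. exact: fmorph_eq0. Qed.

(** For t in the prime field t^2 = t^(p^l+1), so scaling the value by t^2 amounts to substituting t
    x for x. *)
Lemma nsol_quad_sqr (a : F) (t c : 'F_p) : t != 0 ->
  nsol (Q a) (t ^+ 2 * c) = nsol (Q a) c.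
Proof.
move=> nz_t; rewrite -(nsol_quad_emb a c (expf_neq0 2 nz_t)).
have nz_et : emb t != 0 by rewrite emb_eq0.
rewrite -[LHS](nsol_quad_exp a _ nz_et); congr nsol.
by rewrite exprD emb_exp expr1 rmorphXn /= mulrC -expr2.
Qed.

Lemma quad_0l x : Q 0 x = 0.
Proof. by rewrite /quad mul0r (tr0 charF oF). Qed.

(** For fixed x the value is linear in a, hence equidistributed when x is nonzero. The terms a = 0
    and x = 0 of the two sums are equal and cancel. *)
Lemma sum_nsol_quad c :
  (p * \sum_(a | a != 0%R) nsol (Q a) c = (p ^ m).-1 * p ^ m)%N.
Proof.
have Dnz : #|[pred a : F | a != 0]| = (p ^ m).-1 by rewrite -oF -(cardC1 (0 : F)).
have -> : (\sum_(a | a != 0%R) nsol (Q a) c =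
  \sum_(x | x != 0%R) nsol (fun a => tr (x ^+ (p ^ l + 1) * a)%R) c)%N.
  have E : (\sum_a nsol (Q a) c =
      \sum_x nsol (fun a => tr (x ^+ (p ^ l + 1) * a)%R) c)%N.
    under eq_bigr do rewrite nsol_sum; rewrite exchange_big.
    apply: eq_bigr => x _; rewrite nsol_sum; apply: eq_bigr => a _.
    by rewrite /quad mulrC.
  move: E; rewrite (bigD1 0) // [RHS](bigD1 0) //=.
  rewrite [X in (X + _)%N = _]nsol_sum [X in _ = (X + _)%N -> _]nsol_sum.
  under eq_bigr do rewrite quad_0l.
  under [X in _ = (X + _)%N -> _]eq_bigr do
    rewrite addn1 exprS !mul0r (tr0 charF oF).
  by move/addnI.
rewrite big_distrr (eq_bigr (fun _ => p ^ m)%N) => [|x nz_x] /=.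
  by rewrite sum_nat_const Dnz.
by rewrite (nsol_tr charF oF) // expf_neq0.
Qed.

Lemma sum_nsol (f : F -> 'F_p) : (\sum_c nsol f c = p ^ m)%N.
Proof.
rewrite -oF -sum1_card (partition_big f predT) //=.
by apply: eq_bigr => c _; rewrite /nsol -sum1dep_card.
Qed.

Lemma expn_pred1 : (p ^ m = p * p ^ (m - 1))%N.
Proof. by rewrite -expnS subn1 prednK. Qed.

Lemma nsol_quad_variance a :
  \sum_c ((nsol (Q a) c)%:R - (p ^ (m - 1))%:R) ^+ 2 =
    (p%:R - 1) * (p ^ (m - 1) * #|Rad a|)%:R :> rat.
Proof.
have /(congr1 (fun n => n%:R : rat)) := sum_nsol_quad_sqr l charF oF odd_p a.
have /(congr1 (fun n => n%:R : rat)) := sum_nsol (Q a).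
rewrite expn_pred1 !natrD !natrM !natr_sum.
under [in X in _ -> X -> _]eq_bigr do rewrite natrX.
move: (p ^ (m - 1))%N%:R #|_|%:R => q' r E1 E2.
have -> : \sum_c ((nsol (Q a) c)%:R - q') ^+ 2 =
    \sum_c (nsol (Q a) c)%:R ^+ 2 - 2 * q' * \sum_c (nsol (Q a) c)%:R
    + p%:R * q' ^+ 2 :> rat.
  have -> : p%:R * q' ^+ 2 = \sum_(c : 'F_p) q' ^+ 2.
    by rewrite sumr_const card_Fp // mulr_natl.
  rewrite mulr_sumr -sumrB -big_split /=; apply: eq_bigr => c _.
  by ring.
have nz_p : p%:R != 0 :> rat by rewrite pnatr_eq0 -lt0n prime_gt0.
by apply: (mulfI nz_p); move: E1 E2 => /= -> E2; lra.
Qed.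

End ValueCounts.

(** * Odd m: trivial radical and the pairing of c with g c *)

Section OddDegree.

Variables (p m l : nat) (F : finFieldType) (charF : p \in [pchar F]).
Hypothesis (oF : #|F| = (p ^ m)%N) (odd_p : odd p) (l_gt0 : (0 < l)%N).
Hypothesis (odd_m : odd m) (co_ml : coprime m l).

Let p_pr : prime p := pcharf_prime charF.
Let p_gt1 : (1 < p)%N := prime_gt1 p_pr.
Let m_gt0 : (0 < m)%N := card_exp_gt0 oF.
Local Notation emb := (emb charF).
Local Notation Q := (quad l charF).
Local Notation Rad := (@radical p m l F).

Lemma gcd_2l_odd : gcdn (l + l) m = 1%N.
Proof.
apply/eqP; rewrite -/(coprime _ _) addnn -mul2n coprimeMl coprime_sym.
by rewrite coprimen2 odd_m coprime_sym.
Qed.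

(** As gcd(2l, m) = 1, such a u lies in the prime field. *)
Lemma expr_pow2_fixed_odd (u : F) k : u ^+ (p ^ (l + l)) = u -> u ^+ (p ^ k) = u.
Proof.
move=> u_l; have {}u_l : u ^+ p = u.
  have := expr_pow_fixed_gcd oF _ u_l.
  by rewrite gcd_2l_odd expn1; apply; rewrite addn_gt0 l_gt0.
by elim: k => [|k IHk]; rewrite ?expr1 // expnS exprM u_l.
Qed.

(** For nonzero z in the radical, u = a z^(p^l+1) satisfies u^(p^l) = -u. Applying this twice puts u
    in the prime field, so u = -u and u = 0, which is impossible. *)
Lemma radical_odd (a : F) : a != 0 -> Rad a = [set 0].
Proof.
move=> nz_a; apply/setP=> z; rewrite in_set1.
have [->|nz_z] := eqVneq z 0; first exact: radical0.
rewrite (in_radical l charF oF) //; apply/eqP=> uP.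
set u := a * _ in uP; have : u = - u.
  rewrite -uP; apply/esym/expr_pow2_fixed_odd.
  by rewrite expnD exprM uP exprN_pow // uP opprK.
move/(eqf_oppr charF odd_p)/eqP.
by rewrite /u mulf_eq0 expf_eq0 (negPf nz_a) (negPf nz_z) andbF.
Qed.

Lemma exp_unity_odd (x : F) : x ^+ (p ^ l + 1) = 1 -> x ^+ 2 = 1.
Proof.
move=> x1; have nz_x : x != 0.
  by apply: contra_eq_neq x1 => ->; rewrite addn1 expr0n eq_sym oner_neq0.
have xP : x ^+ (p ^ l) = x^-1.
  by apply: (mulIf nz_x); rewrite mulVf // -exprSr -addn1.
rewrite -x1 exprD expr1 expr_pow2_fixed_odd // expnD exprM xP exprVn xP.
by rewrite invrK.
Qed.

Lemma dvdn_predX_odd k : (2 %| (p ^ k).-1)%N.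
Proof.
have : odd (p ^ k) by rewrite oddX odd_p orbT.
by case: (p ^ k)%N => //= n; rewrite dvdn2.
Qed.

Lemma half_predX_odd : ((p ^ m).-1 %/ 2 = p.-1 %/ 2 * \sum_(i < m) p ^ i)%N.
Proof.
have := dvdn_predX_odd 1; rewrite expn1 => dv2.
by rewrite predn_exp divn_mulAC.
Qed.

Lemma odd_geom n : odd (\sum_(i < n) p ^ i) = odd n.
Proof.
elim: n => [|n IHn]; first by rewrite big_ord0.
by rewrite big_ord_recr /= oddD IHn oddX odd_p orbT addbT.
Qed.

Lemma expf_half_pred (K : finFieldType) (v : K) :
  (2 %| #|K|.-1)%N -> v != 0 ->
  v ^+ (#|K|.-1 %/ 2) = 1 \/ v ^+ (#|K|.-1 %/ 2) = -1.
Proof.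
move=> dv2 nz_v; have: (v ^+ (#|K|.-1 %/ 2)) ^+ 2 = 1 ^+ 2.
  by rewrite expr1n -exprM divnK // expf_pred_card.
by move/eqP; rewrite eqf_sqr => /orP[] /eqP; [left | right].
Qed.

Lemma nonsquare_Fp : exists2 g : 'F_p, g != 0 & g ^+ (p.-1 %/ 2) = -1.
Proof.
have dv2 : (2 %| #|'F_p|.-1)%N by have := dvdn_predX_odd 1; rewrite expn1 card_Fp.
have [g /andP[nz_g g1]] : exists g : 'F_p, (g != 0) && (g ^+ (p.-1 %/ 2) != 1).
  apply/existsP; apply: contraT; rewrite negb_exists => /forallP sq.
  (* Otherwise p-1 nonzero elements would be among only (p-1)/2 roots of unity. *)
  have : (#|[set~ (0 : 'F_p)%R]| <= #|[set x : 'F_p | x ^+ (p.-1 %/ 2) == 1]%R|)%N.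
    apply/subset_leq_card/subsetP=> x; rewrite !inE => nz_x.
    by have := sq x; rewrite nz_x /= negbK.
  rewrite finField_unity_roots; last first.
    rewrite card_Fp //; apply/dvdnP; exists 2; rewrite mulnC divnK //.
    by move: dv2; rewrite card_Fp.
  rewrite cardsC1 card_Fp // leqNgt ltn_Pdiv //.
  by move: p_gt1; case: (p) => [|[]].
exists g => //; have [] := expf_half_pred dv2 nz_g; rewrite card_Fp // => Eg.
by rewrite Eg eqxx in g1.
Qed.

Section Nonsquare.

Variable g : 'F_p.
Hypotheses (nz_g : g != 0) (g_half : g ^+ (p.-1 %/ 2) = -1).

Lemma exp_image_odd (v : F) :
  v ^+ ((p ^ m).-1 %/ 2) = 1 -> exists x : F, v = x ^+ (p ^ l + 1).
Proof.
move=> v1; apply: (@finField_exp_image F (p ^ l + 1) 2 v).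
- by rewrite oF dvdn_predX_odd.
- by rewrite addn_gt0 orbT.
- exact: exp_unity_odd.
by rewrite oF.
Qed.

(** The exponent is (p-1)/2 times a sum of m odd terms, which is odd. So a nonsquare of the prime
    field stays a nonsquare in F. *)
Lemma emb_nonsquare_half : emb g ^+ ((p ^ m).-1 %/ 2) = -1.
Proof.
rewrite half_predX_odd exprM -rmorphXn /= g_half rmorphN rmorph1.
by rewrite -signr_odd odd_geom odd_m.
Qed.

(** Squares of F are (p^l+1)-th powers, which do not affect the counts. Hence a and g a behave like
    1 and g if a is a square, and like g and 1 if not. *)
Lemma nsol_quad_nonsquare_const c (a : F) : a != 0 ->
  (nsol (Q a) c + nsol (Q (emb g * a)%R) c =
     nsol (Q 1%R) c + nsol (Q (emb g)) c)%N.
Proof.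
move=> nz_a; have nz_eg : emb g != 0 by rewrite emb_eq0.
have P1_gt0 : (0 < p ^ l + 1)%N by rewrite addn1.
have nz_root (y v : F) : v != 0 -> v = y ^+ (p ^ l + 1) -> y != 0.
  by move=> nz_v Dv; move: nz_v; rewrite Dv expf_eq0 P1_gt0.
have dv2 : (2 %| #|F|.-1)%N by rewrite oF dvdn_predX_odd.
have [] := expf_half_pred dv2 nz_a; rewrite oF => Ha.
  have [y Dy] := exp_image_odd Ha; have nz_y := nz_root _ _ nz_a Dy.
  rewrite Dy (nsol_quad_exp _ charF) // -[X in Q X](mul1r).
  by rewrite (nsol_quad_exp _ charF).
have [y Dy] : exists y, emb g * a = y ^+ (p ^ l + 1).
  by apply: exp_image_odd; rewrite exprMn emb_nonsquare_half Ha mulrNN mulr1.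
have [z Dz] : exists z, emb g ^+ 2 = z ^+ (p ^ l + 1).
  apply: exp_image_odd.
  by rewrite exprAC emb_nonsquare_half expr2 mulrNN mulr1.
have nz_y := nz_root _ _ (mulf_neq0 nz_eg nz_a) Dy.
have nz_z := nz_root _ _ (expf_neq0 2 nz_eg) Dz.
rewrite addnC; congr (_ + _)%N.
  by rewrite Dy -[X in Q X](mul1r) (nsol_quad_exp _ charF).
rewrite -(nsol_quad_exp _ charF a c nz_z) -Dz.
have -> : a * emb g ^+ 2 = emb g * y ^+ (p ^ l + 1) by rewrite -Dy; ring.
exact: nsol_quad_exp.
Qed.

(** Scaling turns N_c for a into the count of g c for g a, so the sum does not depend on a.
    Averaging over all nonzero a gives its value. *)
Lemma nsol_quad_nonsquare c (a : F) : a != 0 ->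
  (nsol (Q a) c + nsol (Q a) (g * c)%R = 2 * p ^ (m - 1))%N.
Proof.
move=> nz_a; have nz_eg : emb g != 0 by rewrite emb_eq0.
rewrite -(nsol_quad_emb l charF oF a c nz_g) addnC nsol_quad_nonsquare_const //.
have := sum_nsol_quad l charF oF (g * c).
have [S0 S0E] : exists S0,
    S0 = (nsol (Q 1%R) (g * c)%R + nsol (Q (emb g)) (g * c)%R)%N.
  by eexists.
have Dnz : #|[pred a : F | a != 0]| = (p ^ m).-1 by rewrite -oF -(cardC1 (0 : F)).
have SS : (2 * \sum_(b | b != 0%R) nsol (Q b) (g * c)%R = (p ^ m).-1 * S0)%N.
  rewrite -Dnz -sum_nat_const mul2n -addnn.
  rewrite [X in (_ + X)%N](reindex_inj (mulfI nz_eg)) /=.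
  under [X in (_ + X)%N]eq_bigl do rewrite mulf_eq0 (negPf nz_eg) /=.
  rewrite -big_split /=; apply: eq_bigr => b nz_b.
  by rewrite S0E nsol_quad_nonsquare_const.
rewrite -S0E => E.
have q1 : (0 < (p ^ m).-1)%N by rewrite -oF card_finField_pred_gt0.
move: E SS; rewrite {2}(expn_pred1 oF); move: q1 (prime_gt0 p_pr).
move: (p ^ m).-1 (p ^ (m - 1))%N (\sum_(_ | _) _)%N => k q' S k_gt0 p_gt0 E SS.
apply/eqP; rewrite -(eqn_pmul2l k_gt0) -(eqn_pmul2l p_gt0) -SS.
by apply/eqP; rewrite mulnCA E; ring.
Qed.

Lemma nsol_quad_0_odd (a : F) : a != 0 -> nsol (Q a) 0 = (p ^ (m - 1))%N.
Proof.
move=> nz_a; have := nsol_quad_nonsquare 0 nz_a; rewrite mulr0.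
by move: (nsol _ _) (p ^ _)%N => n q'; lia.
Qed.

Lemma nsol_quad_nonsquareE (a : F) c : a != 0 ->
  (nsol (Q a) (g * c))%:R = 2 * (p ^ (m - 1))%:R - (nsol (Q a) c)%:R :> rat.
Proof.
move=> nz_a; have /(congr1 (fun n => n%:R : rat)) := nsol_quad_nonsquare c nz_a.
by rewrite natrD natrM => <-; ring.
Qed.

Lemma nsol_quad_dev_odd (a : F) c : a != 0 -> c != 0 ->
  ((nsol (Q a) c)%:R - (p ^ (m - 1))%:R) ^+ 2 =
  ((nsol (Q a) 1)%:R - (p ^ (m - 1))%:R) ^+ 2 :> rat.
Proof.
move=> nz_a nz_c.
have dv2 : (2 %| #|'F_p|.-1)%N by have := dvdn_predX_odd 1; rewrite expn1 card_Fp.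
have sqP (v : 'F_p) : v != 0 -> v ^+ (p.-1 %/ 2) = 1 ->
    nsol (Q a) v = nsol (Q a) 1.
  move=> nz_v v1; have [||t Dt] := @finField_exp_image 'F_p 2 2 v dv2 isT.
  - by [].
  - by rewrite card_Fp.
  have nz_t : t != 0 by move: nz_v; rewrite Dt expf_eq0.
  by rewrite Dt -[t ^+ 2]mulr1 (nsol_quad_sqr _ _ oF).
have [] := expf_half_pred dv2 nz_c; rewrite card_Fp // => Ec.
  by rewrite sqP.
have <- : nsol (Q a) (g * c) = nsol (Q a) 1.
  by rewrite sqP ?mulf_neq0 // exprMn g_half Ec mulrNN mulr1.
by rewrite nsol_quad_nonsquareE //; ring.
Qed.

Lemma expn_pred_odd : (p ^ (m - 1) = (p ^ (m - 1)./2) ^ 2)%N.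
Proof.
rewrite -expnM muln2; congr (p ^ _)%N.
by move: odd_m m_gt0; case: (m) => //= n; rewrite subn1 /= => /even_halfK.
Qed.

(** The deviation vanishes at c = 0 and has the same square at the p-1 other values, so each carries
    an equal share of the variance. *)
Lemma nsol_quad_odd (a : F) c : a != 0 -> c != 0 ->
  ((nsol (Q a) c)%:R - (p ^ (m - 1))%:R) ^+ 2 = (p ^ (m - 1)./2)%:R ^+ 2 :> rat.
Proof.
move=> nz_a nz_c; rewrite nsol_quad_dev_odd //.
have := nsol_quad_variance l charF oF odd_p a.
rewrite radical_odd // cards1 muln1 (bigD1 0) //= nsol_quad_0_odd //.
rewrite subrr expr0n /= add0r.
under eq_bigr => d nz_d do rewrite nsol_quad_dev_odd //.
rewrite sumr_const.
rewrite card_Fp_neq0 // -natr_pred_prime //.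
rewrite -[_ ^+ 2 *+ _]mulr_natl -natrX -expn_pred_odd; apply: mulfI.
by rewrite pnatr_eq0 -lt0n -ltnS prednK // prime_gt0.
Qed.

(** Of N_c and N_(gc), one is q/p + p^((m-1)/2) and the other q/p - p^((m-1)/2). Doubling the sum
    and pairing c with g c makes it irrelevant which is which. *)
Lemma sum_quad_pred_odd (a : F) (B : pred rat) : a != 0 ->
  2 * (\sum_c B (nsol (Q a) c)%:R)%N%:R =
  2 * (B (p ^ (m - 1))%:R)%:R + (p%:R - 1) *
    ((B ((p ^ (m - 1))%:R + (p ^ (m - 1)./2)%:R))%:R
     + (B ((p ^ (m - 1))%:R - (p ^ (m - 1)./2)%:R))%:R) :> rat.
Proof.
move=> nz_a; rewrite (bigD1 0) //= nsol_quad_0_odd // natrD mulrDr.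
congr (_ + _); set b1 := B (_ + _); set b2 := B (_ - _).
set S := (\sum_(_ | _) _)%N.
have -> : 2 * S%:R = (S + S)%N%:R :> rat by rewrite natrD; ring.
suff -> : (S + S = p.-1 * (b1 + b2))%N.
  by rewrite natrM natrD natr_pred_prime.
rewrite /S [X in (_ + X)%N](reindex_inj (mulfI nz_g)) /=.
under [X in (_ + X)%N]eq_bigl do rewrite mulf_eq0 (negPf nz_g) /=.
rewrite -big_split -(card_Fp_neq0 p_pr) -sum_nat_const /=.
apply: eq_bigr => c nz_c.
rewrite nsol_quad_nonsquareE //.
have /eqP := nsol_quad_odd nz_a nz_c; rewrite eqf_sqr => /orP[] /eqP E.
  have -> : (nsol (Q a) c)%:R = (p ^ (m - 1))%:R + (p ^ (m - 1)./2)%:R :> rat.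
    by lra.
  rewrite /b1 /b2; congr (_ + nat_of_bool (B _))%N; by ring.
have -> : (nsol (Q a) c)%:R = (p ^ (m - 1))%:R - (p ^ (m - 1)./2)%:R :> rat by lra.
rewrite addnC /b1 /b2; congr (nat_of_bool (B _) + _)%N; by ring.
Qed.

End Nonsquare.

Lemma sum_word_pred_odd (a : F) (B : pred rat) : a != 0 ->
  (\sum_b \sum_h B (nsol (word l charF a b h) 0%R)%:R)%N%:R =
  (p ^ m)%:R * ((B (p ^ (m - 1))%:R)%:R + (p%:R - 1) / 2 *
    ((B ((p ^ (m - 1))%:R + (p ^ (m - 1)./2)%:R))%:R
     + (B ((p ^ (m - 1))%:R - (p ^ (m - 1)./2)%:R))%:R)) :> rat.
Proof.
move=> nz_a; have [g nz_g g_half] := nonsquare_Fp.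
have := sum_word_pred l charF oF odd_p a (fun n => B n%:R).
rewrite radical_odd // cards1 mul1n muln1 subnn !mul0n addn0 => ->.
rewrite natrM; congr (_ * _).
by have := sum_quad_pred_odd nz_g g_half B nz_a; lra.
Qed.

End OddDegree.

(** * Even m: two radical sizes and the sign of the character sum *)

Section EvenDegree.

Variables (p m l : nat) (F : finFieldType) (charF : p \in [pchar F]).
Hypothesis (oF : #|F| = (p ^ m)%N) (odd_p : odd p) (l_gt0 : (0 < l)%N).
Hypothesis (even_m : ~~ odd m) (co_ml : coprime m l).

Let p_pr : prime p := pcharf_prime charF.
Let p_gt1 : (1 < p)%N := prime_gt1 p_pr.
Let m_gt0 : (0 < m)%N := card_exp_gt0 oF.
Local Notation emb := (emb charF).
Local Notation Q := (quad l charF).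
Local Notation Rad := (@radical p m l F).

Let m2 : m = (2 * m./2)%N. Proof. by rewrite mul2n even_halfK. Qed.

Lemma odd_coprime_even : odd l.
Proof.
move: co_ml; rewrite m2 coprimeMl => /andP[co2 _].
by rewrite -coprime2n.
Qed.

Lemma gcd_2l_even : gcdn (l + l) m = 2.
Proof.
move: co_ml; rewrite addnn -mul2n m2 coprimeMl -muln_gcdr => /andP[_].
by rewrite /coprime gcdnC => /eqP->.
Qed.

(** On the subfield of order p^2 Frobenius is an involution, and l is odd. *)
Lemma expr_pow_even (u : F) : u ^+ (p ^ 2) = u -> u ^+ (p ^ l) = u ^+ p.
Proof.
move=> u2; rewrite -[in LHS](odd_double_half l) odd_coprime_even add1n.
elim: (l./2) => [|j IHj]; first by rewrite expn1.
by rewrite doubleS expnS expnS mulnA mulnn exprM u2.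
Qed.

Lemma expr_pow2_fixed_even (u : F) : u ^+ (p ^ (l + l)) = u -> u ^+ (p ^ 2) = u.
Proof.
move/(expr_pow_fixed_gcd oF); rewrite gcd_2l_even; apply.
by rewrite addn_gt0 l_gt0.
Qed.

(** Either equation puts x in the subfield of order p^2, where the powers p^l and p agree. *)
Lemma exp_unity_even (x : F) : (x ^+ (p ^ l + 1) == 1) = (x ^+ (p + 1) == 1).
Proof.
have inv_pow k : x ^+ (p ^ k + 1) = 1 -> x ^+ (p ^ (k + k)) = x.
  move=> x1; have nz_x : x != 0.
    by apply: contra_eq_neq x1 => ->; rewrite addn1 expr0n eq_sym oner_neq0.
  have xP : x ^+ (p ^ k) = x^-1.
    by apply: (mulIf nz_x); rewrite mulVf // -exprSr -addn1.
  by rewrite expnD exprM xP exprVn xP invrK.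
apply/eqP/eqP => x1; have x2 : x ^+ (p ^ 2) = x.
- exact/expr_pow2_fixed_even/inv_pow.
- by rewrite -x1 !exprD expr_pow_even.
- by apply: (inv_pow 1%N); rewrite expn1.
by rewrite -x1 !exprD expr_pow_even.
Qed.

Lemma dvdn_psqr_even : (p ^ 2 - 1 %| (p ^ m).-1)%N.
Proof. by rewrite subn1 [in X in (_ %| X)%N]m2 expnM dvdn_pred_predX. Qed.

Lemma psqr_pred : (p ^ 2 - 1 = (p - 1) * (p + 1))%N.
Proof. by rewrite -subn_sqr exp1n. Qed.

Lemma dvdn_p1_even : (p + 1 %| (p ^ m).-1)%N.
Proof. by apply: dvdn_trans dvdn_psqr_even; rewrite psqr_pred dvdn_mull. Qed.

(** Since p-1 divides (q-1)/(p+1), every nonzero c of the prime field is a (p^l+1)-th power in F;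
    scaling a by it leaves the counts unchanged. *)
Lemma nsol_quad_neq0_even (a : F) c : a != 0 -> c != 0 ->
  nsol (Q a) c = nsol (Q a) 1.
Proof.
move=> nz_a nz_c; rewrite -[RHS](nsol_quad_emb l charF oF a 1 nz_c) mulr1.
have nz_ec : emb c != 0 by rewrite emb_eq0.
have [y Dy] : exists y, emb c = y ^+ (p ^ l + 1).
  apply: (@finField_exp_image F (p ^ l + 1) (p + 1) (emb c)).
  - by rewrite oF dvdn_p1_even.
  - by rewrite addn_gt0 orbT.
  - by move=> x /eqP; rewrite exp_unity_even => /eqP.
  have /dvdnP[j Dj] : (p - 1 %| #|F|.-1 %/ (p + 1))%N.
    rewrite oF dvdn_divRL ?dvdn_p1_even // -psqr_pred.
    exact: dvdn_psqr_even.
  rewrite Dj mulnC exprM -rmorphXn /= subn1.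
  have := expf_pred_card nz_c; rewrite card_Fp // => ->.
  by rewrite rmorph1 expr1n.
have nz_y : y != 0 by move: nz_ec; rewrite Dy expf_eq0 addn_gt0 orbT.
by rewrite Dy mulrC (nsol_quad_exp _ charF).
Qed.

(** Given one nonzero z in the radical, z t is in it exactly when t is 0 or t^(p^2-1) = 1: the
    condition on t reduces to t^(p^(2l)) = t, and gcd(2l, m) = 2. *)
Lemma card_radical_even (a : F) : a != 0 ->
  #|Rad a| = 1%N \/ #|Rad a| = (p ^ 2)%N.
Proof.
move=> nz_a; have P1_gt0 : (0 < p ^ l + 1)%N by rewrite addn1.
have [/existsP[z /andP[rad_z nz_z]] | no_z] :=
    boolP [exists z, (z \in Rad a) && (z != 0)]; last first.
  left; suff -> : Rad a = [set 0] by rewrite cards1.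
  apply/setP=> z; rewrite in_set1.
  have [->|nz_z] := eqVneq z 0; first exact: radical0.
  apply: contraNF no_z => rad_z; apply/existsP; exists z.
  by rewrite rad_z.
right; have radE y : y != 0 ->
    (y \in Rad a) =
      ((a * y ^+ (p ^ l + 1)) ^+ (p ^ l) == - (a * y ^+ (p ^ l + 1))).
  exact: in_radical.
set u := a * z ^+ (p ^ l + 1).
have nz_u : u != 0 by rewrite mulf_neq0 ?expf_neq0.
have uP : u ^+ (p ^ l) = - u by apply/eqP; rewrite -radE.
have shiftE t : t != 0 -> (z * t \in Rad a) = (t ^+ (p ^ 2 - 1) == 1).
  move=> nz_t; rewrite radE ?mulf_neq0 // [(z * t) ^+ _]exprMn mulrA -/u exprMn uP mulNr.
  rewrite eqr_opp (inj_eq (mulfI nz_u)) exprD expr1 exprMn -exprM -expnD.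
  rewrite mulrC (inj_eq (mulfI (expf_neq0 _ nz_t))).
  have psqr_gt0 : (0 < p ^ 2)%N by rewrite expn_gt0 prime_gt0.
  transitivity (t ^+ (p ^ 2) == t).
    apply/eqP/eqP => [|t2]; first exact: expr_pow2_fixed_even.
    rewrite expnD exprM (expr_pow_even t2) exprAC (expr_pow_even t2) -exprM.
    by rewrite mulnn.
  rewrite -{1}(subnK psqr_gt0) addn1 exprS -[X in _ == X]mulr1.
  by rewrite (inj_eq (mulfI nz_t)).
have -> : Rad a = 0 |: [set z * t | t in [set t : F | t ^+ (p ^ 2 - 1) == 1]].
  apply/setP=> y; rewrite in_setU1.
  have [->|nz_y] := eqVneq y 0; first by rewrite (radical0 _ _ charF).
  rewrite /=.
  have Dy : y = z * (y / z) by rewrite mulrC divfK.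
  have nz_t : y / z != 0 by rewrite mulf_neq0 ?invr_eq0.
  rewrite [in LHS]Dy shiftE //; apply/idP/imsetP => [t1|[t t1 Dt]].
    by exists (y / z); rewrite ?inE.
  by move: t1; rewrite inE Dt [z * t]mulrC mulfK.
rewrite cardsU1 card_imset; last exact: mulfI.
rewrite finField_unity_roots ?oF ?dvdn_psqr_even //.
have -> : 0 \notin [set z * t | t in [set t : F | t ^+ (p ^ 2 - 1) == 1]].
  apply/imsetP=> [[t]]; rewrite inE => t1 /esym/eqP.
  rewrite mulf_eq0 (negPf nz_z) /= => /eqP t0; move: t1.
  have psqr_gt1 : (1 < p ^ 2)%N by rewrite -(expn0 p) ltn_exp2l.
  by rewrite t0 expr0n subn_eq0 leqNgt psqr_gt1 eq_sym oner_eq0.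
by rewrite subnKC // expn_gt0 prime_gt0.
Qed.

(** Q_a is constant on the fibers of x^(p^l+1), and those on nonzero x are cosets of the group of
    (p+1)-th roots of unity. The remaining point x = 0 has value 0. *)
Lemma nsol_quad_even_mod (a : F) c :
  exists k, nsol (Q a) c = ((c == 0%R) + k * (p + 1))%N.
Proof.
rewrite nsol_sum (bigD1 0) //= (quad0 _ _ oF) eq_sym.
suff /dvdnP[k ->] : (p + 1 %| \sum_(x | x != 0%R) (Q a x == c))%N by exists k.
rewrite (partition_big (fun x : F => x ^+ (p ^ l + 1)) predT) //=.
apply: dvdn_sum => v _.
have [/existsP[y /andP[nz_y /eqP Dv]] | no_y] :=
    boolP [exists y : F, (y != 0) && (y ^+ (p ^ l + 1) == v)]; last first.
  rewrite big_pred0 // => x; apply: contraNF no_y => ?.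
  by apply/existsP; exists x.
rewrite (eq_bigr (fun _ => (trFp charF (a * v) == c)%R : nat)); last first.
  by move=> x /andP[_ /eqP Dx]; rewrite /quad Dx.
rewrite sum_nat_const dvdn_mulr //.
have: #|[set x : F | x ^+ (p + 1) == 1]| = (p + 1)%N.
  by rewrite finField_unity_roots ?oF ?dvdn_p1_even.
rewrite -(card_imset _ (mulfI nz_y)) => {1}<-.
suff -> : #|[pred x : F | (x != 0) && (x ^+ (p ^ l + 1) == v)]| =
    #|[set y * x | x in [set x : F | x ^+ (p + 1) == 1]]| by [].
apply: eq_card => x; rewrite inE; apply/andP/imsetP => [[nz_x /eqP Dx]|[t]].
  exists (x / y); last by rewrite mulrC divfK.
  by rewrite inE -exp_unity_even expr_div_n Dx Dv divff // -Dv expf_neq0.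
rewrite inE -exp_unity_even => /eqP t1 ->; rewrite exprMn t1 mulr1 Dv eqxx.
split=> //; rewrite mulf_neq0 //; apply: contra_eq_neq t1 => ->.
by rewrite addn1 expr0n eq_sym oner_neq0.
Qed.

(** Since -p is 1 modulo p+1, so is (-p)^n; its opposite is not, because p+1 does not divide 2. *)
Lemma sqr_modn_sign (x j : int) n :
  x = 1 + (p%:R + 1) * j -> x ^+ 2 = (p%:R ^+ n) ^+ 2 -> x = (-1) ^+ n * p%:R ^+ n.
Proof.
move=> xj; have [i Di] : exists i : int, (-1) ^+ n * p%:R ^+ n = 1 + (p%:R + 1) * i.
  elim: n => [|n [i Di]]; first by exists 0; rewrite mulr0 addr0 mulr1.
  exists (- 1 - p%:R * i).
  by rewrite !exprS mulrACA Di; ring.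
have -> : (p%:R ^+ n) ^+ 2 = ((-1) ^+ n * p%:R ^+ n) ^+ 2 :> int.
  by rewrite exprMn sqrr_sign mul1r.
rewrite Di xj => /eqP; rewrite eqf_sqr => /orP[] /eqP // E.
have : (p%:R + 1) * (- (i + j)) = 2 :> int by move: E; lia.
have : 2 < p%:R :> int by rewrite ltr_nat odd_prime_gt2.
by move: (- (i + j)) p%:R => d P P_gt2 Ed; exfalso; case: (lerP d 0) => d0; nia.
Qed.

(** For nonzero a this is the sum of a nontrivial additive character over the values of Q_a, as all
    nonzero values are taken equally often. *)
Local Notation T a := ((nsol (Q a) 0)%:R - (nsol (Q a) 1)%:R).

Lemma sum_quad_even (V : nmodType) (f : nat -> V) (a : F) : a != 0 ->
  \sum_c f (nsol (Q a) c) = f (nsol (Q a) 0) + f (nsol (Q a) 1) *+ p.-1.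
Proof.
move=> nz_a; rewrite (bigD1 0) //=; congr (_ + _).
rewrite -(card_Fp_neq0 p_pr) -sumr_const; apply: eq_bigr => c nz_c.
by rewrite nsol_quad_neq0_even.
Qed.

Lemma nsol_quad_0_even (a : F) : a != 0 ->
  p%:R * (nsol (Q a) 0)%:R = (p ^ m)%:R + (p%:R - 1) * T a :> rat.
Proof.
move=> nz_a; have /(congr1 (fun n => n%:R : rat)) := sum_nsol oF (Q a).
rewrite natr_sum (sum_quad_even (fun n => n%:R : rat)) // => <-.
by rewrite -[_ *+ p.-1]mulr_natl natr_pred_prime //; ring.
Qed.

Lemma nsol_quad_1_even (a : F) : a != 0 ->
  p%:R * (nsol (Q a) 1)%:R = (p ^ m)%:R - T a :> rat.
Proof. by move/nsol_quad_0_even => E; lra. Qed.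

(** With N_0 - q/p = (p-1) T/p and N_c - q/p = -T/p for nonzero c, the variance identity reads (p-1)
    T^2/p = (p-1) (q/p) r. *)
Lemma quad_diff_sqr (a : F) : a != 0 -> T a ^+ 2 = (p ^ m * #|Rad a|)%:R :> rat.
Proof.
move=> nz_a; have := nsol_quad_variance l charF oF odd_p a.
rewrite (sum_quad_even (fun n => (n%:R - (p ^ (m - 1))%:R) ^+ 2 : rat)) //.
rewrite -[_ *+ p.-1]mulr_natl natr_pred_prime //.
have := nsol_quad_0_even nz_a; have := nsol_quad_1_even nz_a.
rewrite (expn_pred1 oF) !natrM.
have p1 : 1 < p%:R :> rat by rewrite ltr1n.
move: (nsol _ 0)%:R (nsol _ 1)%:R (p ^ (m - 1))%:R #|_|%:R p%:R p1.
move=> n0 n1 q' r P p1 E1 E0 E.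
have nzP : P != 0 by lra.
have nzP1 : P - 1 != 0 by lra.
apply: (mulfI nzP1); apply: (mulfI nzP).
have -> : P * ((P - 1) * (P * q' * r)) = P ^+ 2 * ((P - 1) * (q' * r)) by ring.
rewrite -E mulrDr [P ^+ 2 * (_ * _)]mulrCA -!exprMn !mulrBr E0 E1.
by ring.
Qed.

Lemma quad_diff_even (a : F) n : a != 0 -> (p ^ m * #|Rad a| = (p ^ n) ^ 2)%N ->
  T a = (-1) ^+ n * p%:R ^+ n :> rat.
Proof.
move=> nz_a En; pose x : int := T a.
have Dx : T a = x%:~R :> rat by rewrite /x rmorphB /= !rmorph_nat.
have [k0 E0] := nsol_quad_even_mod a 0; have [k1 E1] := nsol_quad_even_mod a 1.
have : x = (-1) ^+ n * p%:R ^+ n.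
  apply: (@sqr_modn_sign _ (k0%:R - k1%:R)).
    rewrite /x E0 E1 eqxx oner_eq0 add0n natrD !natrM natrD /=.
    by ring.
  apply: (@intr_inj rat); rewrite rmorphXn /= -Dx quad_diff_sqr // En.
  by rewrite !natrX !rmorphXn /= rmorph_nat.
move/(congr1 (fun y : int => y%:~R : rat)); rewrite -Dx => ->.
by rewrite rmorphM !rmorphXn rmorphN1 /= rmorph_nat.
Qed.

Lemma expn_even : (p ^ m = (p ^ m./2) ^ 2)%N.
Proof. by rewrite -expnM mulnC -m2. Qed.

Lemma quad_diff_radical1 (a : F) : a != 0 -> #|Rad a| = 1%N ->
  T a = (-1) ^+ m./2 * p%:R ^+ m./2 :> rat.
Proof. by move=> nz_a r1; apply: quad_diff_even; rewrite // r1 muln1 expn_even. Qed.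

(** Here q r is the square of p^(m/2+1), so the sign is opposite to that for a trivial radical. *)
Lemma quad_diff_radical_p2 (a : F) : a != 0 -> #|Rad a| = (p ^ 2)%N ->
  T a = - (-1) ^+ m./2 * p%:R ^+ m./2 * p%:R :> rat.
Proof.
move=> nz_a r2; rewrite (@quad_diff_even _ (m./2).+1) // ?exprS ?exprSr; last first.
  by rewrite r2 expn_even -expnMn -expnSr.
by ring.
Qed.

(** Over nonzero a, the values 0 and 1 are taken equally often in total, so the T(a) sum to 0. With
    n1 degenerate and n2 nondegenerate a this gives n2 = p n1, while n1 + n2 = q-1. *)
Lemma card_degenerate_even :
  (#|[set a : F | (a != 0%R) && (#|Rad a| == p ^ 2)]| * (p + 1) = (p ^ m).-1)%N.
Proof.
have E : (\sum_(a | a != 0%R) nsol (Q a) 0%R =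
    \sum_(a | a != 0%R) nsol (Q a) 1%R)%N.
  by apply/eqP; rewrite -(eqn_pmul2l (prime_gt0 p_pr)) !(sum_nsol_quad l charF oF).
have : \sum_(a : F | a != 0) T a = 0 :> rat.
  by rewrite sumrB -!natr_sum E subrr.
rewrite (bigID (fun a => #|Rad a| == p ^ 2)%N) /=.
rewrite (eq_bigr (fun _ => - (-1) ^+ m./2 * p%:R ^+ m./2 * p%:R)); last first.
  by move=> a /andP[nz_a /eqP r2]; rewrite quad_diff_radical_p2.
rewrite sumr_const.
rewrite (eq_bigr (fun _ => (-1) ^+ m./2 * p%:R ^+ m./2)); last first.
  move=> a /andP[nz_a r2]; apply: quad_diff_radical1 => //.
  by have [//|/eqP] := card_radical_even nz_a; rewrite (negPf r2).
rewrite sumr_const.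
set n1 := #|_|; set n2 := #|_|.
have -> : #|[set a : F | (a != 0%R) && (#|Rad a| == p ^ 2)]|%N = n1.
  by apply: eq_card => a; rewrite inE.
have <- : (n1 + n2)%N = (p ^ m).-1.
  rewrite -oF -(cardC1 (0 : F)) -sum1_card.
  by rewrite (bigID (fun a => #|Rad a| == p ^ 2)%N) /= /n1 /n2 -!sum1_card.
rewrite -[_ *+ n1]mulr_natl -[_ *+ n2]mulr_natl => /eqP; rewrite !mulrA.
have -> : n1%:R * - (-1) ^+ m./2 * p%:R ^+ m./2 * p%:R
      + n2%:R * (-1) ^+ m./2 * p%:R ^+ m./2 =
    ((-1) ^+ m./2 * p%:R ^+ m./2) * (n2%:R - n1%:R * p%:R) :> rat by ring.
rewrite !mulf_eq0 signr_eq0 expf_eq0 pnatr_eq0 (gtn_eqF (prime_gt0 p_pr)) andbF /=.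
rewrite subr_eq0 -natrM eqr_nat => /eqP->.
by rewrite mulnDr muln1 addnC.
Qed.

Lemma natr_card_even : (p ^ m)%:R = p%:R * (p ^ (m - 1))%:R :> rat.
Proof. by rewrite (expn_pred1 oF) natrM. Qed.

Lemma exp_half_pred : p%:R ^+ m./2 = p%:R * p%:R ^+ (m./2 - 1) :> rat.
Proof.
rewrite -exprS subn1 prednK //.
by move: m_gt0; rewrite [in X in X -> _]m2; case: (m./2).
Qed.

Lemma sum_word_pred_even_1 (a : F) (B : pred rat) : a != 0 -> #|Rad a| = 1%N ->
  (\sum_b \sum_h B (nsol (word l charF a b h) 0%R)%:R)%N%:R =
  (p ^ m)%:R *
   ((B ((p ^ (m - 1))%:R + (-1) ^+ m./2 * (p%:R - 1) * p%:R ^+ (m./2 - 1)))%:R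
    + (p%:R - 1) *
      (B ((p ^ (m - 1))%:R - (-1) ^+ m./2 * p%:R ^+ (m./2 - 1)))%:R) :> rat.
Proof.
move=> nz_a r1; have := sum_word_pred l charF oF odd_p a (fun n => B n%:R).
rewrite r1 mul1n muln1 subnn !mul0n addn0 => ->.
rewrite natrM natr_sum (sum_quad_even (fun n => (B n%:R)%:R : rat)) //.
rewrite -[_ *+ p.-1]mulr_natl natr_pred_prime //.
have nzP : p%:R != 0 :> rat by rewrite pnatr_eq0 -lt0n prime_gt0.
have := nsol_quad_0_even nz_a; have := nsol_quad_1_even nz_a.
rewrite quad_diff_radical1 // natr_card_even exp_half_pred => E1 E0.
congr (_ * ((nat_of_bool (B _))%:R + _ * (nat_of_bool (B _))%:R)).
- by apply: (mulfI nzP); rewrite E0; ring.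
by apply: (mulfI nzP); rewrite E1; ring.
Qed.

(** The factor p^2 on the left is the size of the radical; the last term comes from the b outside
    the image of [polar a]. *)
Lemma sum_word_pred_even_p2 (a : F) (B : pred rat) :
    a != 0 -> #|Rad a| = (p ^ 2)%N ->
  p%:R ^+ 2 * (\sum_b \sum_h B (nsol (word l charF a b h) 0%R)%:R)%N%:R =
  (p ^ m)%:R *
   ((B ((p ^ (m - 1))%:R - (-1) ^+ m./2 * (p%:R - 1) * p%:R ^+ m./2))%:R
    + (p%:R - 1) *
      (B ((p ^ (m - 1))%:R + (-1) ^+ m./2 * p%:R ^+ m./2))%:R)
  + (p ^ m)%:R * (p%:R ^+ 2 - 1) * p%:R * (B (p ^ (m - 1))%:R)%:R :> rat.
Proof.
move=> nz_a r2.
have /(congr1 (fun n => n%:R : rat)) :=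
  sum_word_pred l charF oF odd_p a (fun n => B n%:R).
rewrite r2 natrM natrX => ->.
rewrite natrD !natrM natrB; last by rewrite leq_pmulr // expn_gt0 prime_gt0.
rewrite natrM [(p ^ 2)%:R]natrX.
rewrite natr_sum (sum_quad_even (fun n => (B n%:R)%:R : rat)) //.
rewrite -[_ *+ p.-1]mulr_natl natr_pred_prime //.
have nzP : p%:R != 0 :> rat by rewrite pnatr_eq0 -lt0n prime_gt0.
have := nsol_quad_0_even nz_a; have := nsol_quad_1_even nz_a.
rewrite quad_diff_radical_p2 // => E1 E0.
congr (_ * ((nat_of_bool (B _))%:R + _ * (nat_of_bool (B _))%:R) + _ * _ * _).
- by apply: (mulfI nzP); rewrite E0 natr_card_even; ring.
- by apply: (mulfI nzP); rewrite E1 natr_card_even; ring.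
by ring.
Qed.

End EvenDegree.

(** * Weight tables and distinctness of their weights *)

Lemma has_weight_distribution_sum (R : finNmodType) n (C : {set 'rV[R]_n})
    (table : seq (rat * rat)) :
    uniq (unzip1 table) ->
    (forall B : pred rat, #|[set c in C | B (hamming_weight c)%:R]|%:R =
       \sum_(r <- table) (B r.1)%:R * r.2) ->
  has_weight_distribution C table.
Proof.
move=> uniq_w sumC; split=> [r table_r|c Cc].
  (* A singleton predicate isolates one row, as the weights are distinct; below, the complement of
     the list of weights shows that no other weight occurs. *)
  rewrite (sumC (pred1 r.1)) (bigD1_seq r) ?(map_uniq uniq_w) //= eqxx mul1r.
  rewrite big_seq_cond big1 ?addr0 // => r' /andP[table_r' ne_r].
  case: eqP => [eq_w|_]; last by rewrite mul0r.
  case/eqP: ne_r; rewrite -(nth_index (0, 0) table_r) -(nth_index (0, 0) table_r').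
  congr nth; apply/eqP; rewrite -(nth_uniq 0 _ _ uniq_w) ?size_map ?index_mem //.
  by rewrite !(nth_map (0, 0)) ?index_mem // !nth_index // eq_w.
have := sumC [pred w | w \notin unzip1 table].
rewrite big_seq big1 => [|r table_r]; last by rewrite /= map_f // mul0r.
move/eqP; rewrite pnatr_eq0 cards_eq0 => /eqP/setP/(_ c).
by rewrite !inE Cc /= => /negbFE.
Qed.

(** Here P is p and w is p^((m-1)/2). Bounding the products first leaves linear arithmetic. *)
Lemma uniq_weights_odd (P w : rat) : 3 <= P -> 3 <= w ->
  uniq [:: 0; w ^+ 2 * (P - 1); w ^+ 2 * (P - 1) + w; w ^+ 2 * (P - 1) - w;
           P * w ^+ 2].
Proof.
move=> P_ge3 w_ge3.
have w2 : 3 * w <= w ^+ 2 by rewrite expr2 ler_wpM2r //; lra.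
have W2 : w ^+ 2 * 2 <= w ^+ 2 * (P - 1) by rewrite ler_wpM2l ?sqr_ge0 //; lra.
rewrite /= !inE !negb_or !andbA.
by repeat (apply/andP; split); rewrite //; apply/eqP; lra.
Qed.

(** Here P is p, X is p^(m/2-1) and s is (-1)^(m/2); P <= X holds because m is at least 4. *)
Lemma uniq_weights_even (P X s : rat) : 3 <= P -> P <= X -> s = 1 \/ s = -1 ->
  uniq [:: 0; P * X ^+ 2 * (P - 1); P * X ^+ 2 * (P - 1) - s * X * (P - 1);
           P * X ^+ 2 * (P - 1) + s * X;
           P * X ^+ 2 * (P - 1) + s * (P * X) * (P - 1);
           P * X ^+ 2 * (P - 1) - s * (P * X); P * (P * X ^+ 2)].
Proof.
move=> P_ge3 X_geP sE.
have X_ge3 : 3 <= X by lra.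
have PX_gt0 : 0 < P * X by rewrite mulr_gt0 //; lra.
have h4 : 3 * X <= P * X by rewrite ler_wpM2r //; lra.
have h3 : P * X * 2 <= P * X * (P - 1) by rewrite ler_wpM2l ?(ltW PX_gt0) //; lra.
have h5 : P * X * (P - 1) * 3 <= P * X * (P - 1) * X.
  by rewrite ler_wpM2l // mulr_ge0 ?(ltW PX_gt0) //; lra.
have h6 : P * X * (P - 1) < P * X * X by rewrite ltr_pM2l //; lra.
rewrite /= !inE !negb_or !andbA.
by case: sE => ->; repeat (apply/andP; split); rewrite //; apply/eqP; lra.
Qed.

Section Tables.

Variables (p m : nat).
Hypotheses (p_pr : prime p) (odd_p : odd p) (m_ge3 : (3 <= m)%N).
Local Notation P := (p%:R : rat).

Definition table_odd : seq (rat * rat) :=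
  [:: (0, 1);
      (P ^+ (m - 1) * (P - 1), P * (P ^+ (m - 1) + 1) * (P ^+ m - 1));
      (P ^+ (m - 1) * (P - 1) + P ^+ ((m - 1)./2),
       1 / 2 * P ^+ m * (P - 1) * (P ^+ m - 1));
      (P ^+ (m - 1) * (P - 1) - P ^+ ((m - 1)./2),
       1 / 2 * P ^+ m * (P - 1) * (P ^+ m - 1));
      (P ^+ m, P - 1)].

Definition table_even : seq (rat * rat) :=
  let s : rat := (-1) ^+ m./2 in
  [:: (0, 1);
      (P ^+ (m - 1) * (P - 1),
       P * (P ^+ (m - 1) - P ^+ (m - 2) + 1) * (P ^+ m - 1));
      (P ^+ (m - 1) * (P - 1) - s * P ^+ (m./2 - 1) * (P - 1),
       P ^+ (m + 1) * (P ^+ m - 1) / (P + 1));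
      (P ^+ (m - 1) * (P - 1) + s * P ^+ (m./2 - 1),
       P ^+ (m + 1) * (P - 1) * (P ^+ m - 1) / (P + 1));
      (P ^+ (m - 1) * (P - 1) + s * P ^+ (m./2) * (P - 1),
       P ^+ (m - 2) * (P ^+ m - 1) / (P + 1));
      (P ^+ (m - 1) * (P - 1) - s * P ^+ (m./2),
       P ^+ (m - 2) * (P - 1) * (P ^+ m - 1) / (P + 1));
      (P ^+ m, P - 1)].

Lemma natr_odd_prime_ge3 : 3 <= P.
Proof. by rewrite ler_nat odd_prime_gt2. Qed.

Lemma natr_exp_pred : P ^+ m = P * P ^+ (m - 1).
Proof. by rewrite -exprS subn1 prednK //; apply: ltn_trans m_ge3. Qed.

Lemma uniq_table_odd : odd m -> uniq (unzip1 table_odd).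
Proof.
move=> odd_m; pose w := P ^+ (m - 1)./2.
have Dw : P ^+ (m - 1) = w ^+ 2.
  rewrite /w -exprM muln2 even_halfK //; move: odd_m m_ge3.
  by case: (m) => //= n; rewrite subn1.
have w_ge3 : 3 <= w.
  apply: le_trans natr_odd_prime_ge3 _.
  rewrite -[X in X <= _]expr1 ler_eXn2l ?ltr1n ?prime_gt1 //.
  by rewrite half_gt0; move: m_ge3; case: (m) => [|[|[]]].
rewrite /table_odd /= natr_exp_pred Dw.
exact: (uniq_weights_odd natr_odd_prime_ge3).
Qed.

Lemma uniq_table_even : ~~ odd m -> uniq (unzip1 table_even).
Proof.
move=> even_m; pose X := P ^+ (m./2 - 1).
have m_half : (2 <= m./2)%N.
  by have := even_halfK even_m; lia.
have DX : P ^+ m./2 = P * X by rewrite /X -exprS subn1 prednK //; lia.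
have DX2 : P ^+ (m - 1) = P * X ^+ 2.
  rewrite /X -exprM -exprS; congr (_ ^+ _).
  by have := even_halfK even_m; lia.
have X_geP : P <= X.
  by rewrite -[X in X <= _]expr1 ler_eXn2l ?ltr1n ?prime_gt1 //; lia.
have sE : (-1) ^+ m./2 = 1 :> rat \/ (-1) ^+ m./2 = -1 :> rat.
  by rewrite -signr_odd; case: (odd m./2); [right | left].
rewrite /table_even /= natr_exp_pred DX DX2.
exact: (uniq_weights_even natr_odd_prime_ge3).
Qed.

End Tables.

(** * The code: parametrization, dimension and weight counts *)

Section Code.

Variables (p m l : nat) (F : finFieldType) (charF : p \in [pchar F]).
Variable e : 'I_(p ^ m) -> F.
Hypothesis (oF : #|F| = (p ^ m)%N) (odd_p : odd p) (l_gt0 : (0 < l)%N).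
Hypothesis (m_ge3 : (3 <= m)%N) (co_ml : coprime m l) (bij_e : bijective e).

Let p_pr : prime p := pcharf_prime charF.
Let p_gt1 : (1 < p)%N := prime_gt1 p_pr.
Let m_gt0 : (0 < m)%N := card_exp_gt0 oF.
Local Notation emb := (emb charF).
Local Notation tr := (trFp charF).
Local Notation W := (word l charF).
Local Notation D2 := (code_D2 charF e l).
Local Notation P := (p%:R : rat).
Let Pm : P ^+ m = P * P ^+ (m - 1) := natr_exp_pred p m_ge3.

Lemma wordD a b h a' b' h' x :
  W (a + a') (b + b') (h + h') x = W a b h x + W a' b' h' x.
Proof. by rewrite /word addrACA -(trD charF oF); congr (tr _ + _); ring. Qed.

Lemma wordZ t a b h x :
  W (emb t * a) (emb t * b) (t * h) x = t * W a b h x.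
Proof. by rewrite /word mulrDr -(trZ charF oF); congr (tr _ + _); ring. Qed.

Lemma radical_lt (a : F) : a != 0 -> (#|radical p m l a| < p ^ m)%N.
Proof.
move=> nz_a; have [odd_m|even_m] := boolP (odd m).
  rewrite (radical_odd charF oF) // cards1 -[X in (X < _)%N](expn0 p).
  by rewrite ltn_exp2l.
have [->|->] := card_radical_even charF oF l_gt0 even_m co_ml nz_a.
  by rewrite -[X in (X < _)%N](expn0 p) ltn_exp2l.
by rewrite ltn_exp2l.
Qed.

Lemma word_eq0 a b h : (forall x, W a b h x = 0) -> [/\ a = 0, b = 0 & h = 0].
Proof.
move=> w0; have h0 : h = 0.
  have := w0 0; rewrite (wordE _ _ oF) (quad0 _ _ oF) mulr0 (tr0 charF oF).
  by rewrite !add0r.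
have [x1 tr_x1] := tr_onto charF oF 1.
have a0 : a = 0.
  apply/eqP; apply: contraT => nz_a.
  have := radical_lt nz_a; rewrite -oF -cardsT ltnNge subset_leq_card //.
  apply/subsetP=> z _; rewrite inE; apply: contraT => nz_Lz.
  (* This y makes the polar term equal to 1, so the word at y + z is 1 more than the sum of its
     values at y and z. *)
  pose y := x1 / polar p m l a z; have := w0 (y + z).
  rewrite (wordE _ _ oF) (quadD _ _ oF) mulrDr (trD charF oF).
  rewrite {2}/y [polar _ _ _ _ _ * _]mulrC divfK // tr_x1.
  have := w0 z; have := w0 y; rewrite !(wordE _ _ oF) h0 !addr0 => Ey Ez.
  have -> : quad l charF a y + quad l charF a z + 1 + (tr (b * y) + tr (b * z)) =
    (quad l charF a y + tr (b * y)) + (quad l charF a z + tr (b * z)) + 1 by ring.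
  by rewrite Ey Ez !add0r => /eqP; rewrite oner_eq0.
split=> //; apply/eqP; apply: contraT => nz_b.
have := w0 (x1 / b); rewrite (wordE _ _ oF) a0 (quad_0l _ _ oF) h0 add0r addr0.
by rewrite mulrC divfK // tr_x1 => /eqP; rewrite oner_eq0.
Qed.

Lemma hamming_weight_word a b h :
  (hamming_weight (\row_i W a b h (e i)))%:R =
    P ^+ m - (nsol (W a b h) 0)%:R :> rat.
Proof.
have -> : P ^+ m = #|F|%:R by rewrite oF natrX.
rewrite -(cardC [pred x | W a b h x == 0]) natrD /nsol.
have -> : #|[set x | W a b h x == 0]| = #|[pred x | W a b h x == 0]|.
  by apply: eq_card => x; rewrite !inE.
rewrite [X in _ = X - _]addrC addrK /hamming_weight; congr (_%:R).
rewrite -(card_imset _ (bij_inj bij_e)); apply: eq_card => x.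
have [e' eK e'K] := bij_e.
apply/imsetP/idP => [[i] /[!inE] /[!mxE] wi -> //|nz_x].
by exists (e' x); rewrite ?e'K // !inE mxE e'K.
Qed.

Definition codeword (u : F * F * 'F_p) : 'rV['F_p]_(p ^ m) :=
  \row_i W u.1.1 u.1.2 u.2 (e i).

Lemma codeword_inj : injective codeword.
Proof.
move=> [[a b] h] [[a' b'] h'] /rowP eq_w.
have [e' eK e'K] := bij_e.
have [x | a0 b0 h0] := @word_eq0 (a - a') (b - b') (h - h').
  have := eq_w (e' x); rewrite !mxE /= e'K => Ew.
  have := wordD (a - a') (b - b') (h - h') a' b' h' x.
  rewrite !subrK Ew => /eqP; rewrite -subr_eq0 opprD addrA addrAC subrr add0r.
  by rewrite oppr_eq0 => /eqP.
by rewrite (subr0_eq a0) (subr0_eq b0) (subr0_eq h0).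
Qed.

Lemma code_D2E : D2 = [set codeword u | u in [set: F * F * 'F_p]].
Proof.
apply/setP=> c; rewrite inE; apply/existsP/imsetP => [[a] | [[[a b] h] _ ->]].
  by case/existsP=> b /existsP[h /eqP->]; exists (a, b, h); rewrite ?inE.
by exists a; apply/existsP; exists b; apply/existsP; exists h.
Qed.

Lemma card_code_D2 : #|D2| = (p ^ (2 * m + 1))%N.
Proof.
rewrite code_D2E card_imset; last exact: codeword_inj.
by rewrite cardsT !card_prod oF card_Fp // -expnD -expnSr addnn -mul2n addn1.
Qed.

Lemma code_D2_dim : linear_code_of_dim D2 (2 * m + 1).
Proof.
have D2_0 : 0 \in D2.
  rewrite code_D2E; apply/imsetP; exists (0, 0, 0); rewrite ?inE //.
  apply/rowP=> i; rewrite !mxE /= (wordE _ _ oF) (quad_0l _ _ oF) mul0r (tr0 charF oF).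
  by rewrite !addr0.
have D2_D u v : u \in D2 -> v \in D2 -> u + v \in D2.
  rewrite code_D2E => /imsetP[[[a b] h] _ ->] /imsetP[[[a' b'] h'] _ ->].
  apply/imsetP; exists (a + a', b + b', h + h'); rewrite ?inE //.
  by apply/rowP=> i; rewrite !mxE wordD.
have D2_Z t u : u \in D2 -> t *: u \in D2.
  rewrite code_D2E => /imsetP[[[a b] h] _ ->].
  apply/imsetP; exists (emb t * a, emb t * b, t * h); rewrite ?inE //.
  by apply/rowP=> i; rewrite !mxE wordZ.
have VE : <<enum D2>>%VS =i D2.
  move=> v; apply/idP/idP => [|D2_v]; last by rewrite memv_span ?mem_enum.
  move/(@coord_span _ _ _ (in_tuple (enum D2)))->.
  apply: (big_ind (fun u => u \in D2)) => // i _; apply: D2_Z.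
  by rewrite -mem_enum mem_nth.
exists <<enum D2>>%VS => //.
(* The dimension is read off as the exponent of p in the number of codewords. *)
have := card_vspace <<enum D2>>%VS; rewrite (eq_card VE) card_code_D2 card_Fp //.
by move/eqP; rewrite eqn_exp2l // => /eqP->.
Qed.

Lemma card_code_pred (B : pred rat) :
  #|[set c in D2 | B (hamming_weight c)%:R]| =
    (\sum_a \sum_b \sum_h B (P ^+ m - (nsol (W a b h) 0%R)%:R)%R)%N.
Proof.
rewrite pair_big pair_big /=.
rewrite -sum1dep_card big_mkcondr /= code_D2E big_imset /=; last first.
  by move=> u v _ _; apply: codeword_inj.
apply: eq_big => [u|u _]; first by rewrite inE.
by rewrite hamming_weight_word; case: ifP => _.
Qed.

Let card_nz : #|(fun a : F => a != 0)|%:R = P ^+ m - 1.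
Proof.
have -> : #|(fun a : F => a != 0)| = (p ^ m).-1 by rewrite -oF -(cardC1 (0 : F)).
by rewrite -natrX -[in RHS](@prednK (p ^ m)) ?expn_gt0 ?prime_gt0 // -natr1 addrK.
Qed.

(** For a = 0 the words are affine: the zero word has q zeros, the p-1 other constants none, and
    those with b nonzero q/p each. *)
Lemma sum_word_pred_0 (B : pred rat) :
  (\sum_b \sum_h B (nsol (W 0%R b h) 0%R)%:R)%N%:R =
    (B (P ^+ m))%:R + (P - 1) * (B 0)%:R
    + (P ^+ m - 1) * P * (B (P ^+ (m - 1)))%:R :> rat.
Proof.
rewrite (bigD1 0) //= natrD; congr (_ + _).
  have nsol_cst h : nsol (W 0 0 h) 0 = (if h == 0%R then p ^ m else 0)%N.
    rewrite nsol_sum (eq_bigr (fun _ => (h == 0)%R : nat)) => [|x _].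
      by rewrite sum_nat_const oF; case: eqP; rewrite ?muln1 ?muln0.
    by rewrite (wordE _ _ oF) (quad_0l _ _ oF) mul0r (tr0 charF oF) !add0r.
  rewrite (bigD1 0) //= nsol_cst eqxx natrD natrX; congr (_ + _).
  rewrite (eq_bigr (fun _ => B 0 : nat)) => [|h nz_h].
    by rewrite sum_nat_const card_Fp_neq0 // natrM natr_pred_prime.
  by rewrite nsol_cst (negPf nz_h).
rewrite (eq_bigr (fun _ => p * B (P ^+ (m - 1))%R)%N) => [|b nz_b].
  by rewrite sum_nat_const !natrM mulrA card_nz.
rewrite (eq_bigr (fun _ => B (P ^+ (m - 1)) : nat)) => [|h _].
  by rewrite sum_nat_const card_Fp.
suff -> : nsol (W 0 b h) 0 = (p ^ (m - 1))%N by rewrite natrX.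
apply/eqP; rewrite -(eqn_pmul2l (prime_gt0 p_pr)) -(expn_pred1 oF).
rewrite -(nsol_tr charF oF (- h) nz_b) !nsol_sum; apply/eqP; congr (_ * _)%N.
apply: eq_bigr => x _; rewrite (wordE _ _ oF) (quad_0l _ _ oF) add0r.
by rewrite addr_eq0.
Qed.

Lemma card_code_odd (B : pred rat) : odd m ->
  #|[set c in D2 | B (hamming_weight c)%:R]|%:R =
    \sum_(r <- table_odd p m) (B r.1)%:R * r.2.
Proof.
(* [B'] translates a test on weights into a test on numbers of zeros. *)
move=> odd_m; pose B' z := B (P ^+ m - z).
rewrite card_code_pred (bigD1 0) //= natrD (sum_word_pred_0 B') natr_sum.
under eq_bigr => a nz_a do
  rewrite (sum_word_pred_odd charF oF odd_p l_gt0 odd_m co_ml B' nz_a).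
rewrite sumr_const -[_ *+ #|_|]mulr_natl card_nz /B' !natrX.
rewrite !big_cons big_nil /= subrr subr0.
have -> : P ^+ m - P ^+ (m - 1) = P ^+ (m - 1) * (P - 1) by rewrite Pm; ring.
have -> : P ^+ m - (P ^+ (m - 1) + P ^+ (m - 1)./2) =
  P ^+ (m - 1) * (P - 1) - P ^+ (m - 1)./2 by rewrite Pm; ring.
have -> : P ^+ m - (P ^+ (m - 1) - P ^+ (m - 1)./2) =
  P ^+ (m - 1) * (P - 1) + P ^+ (m - 1)./2 by rewrite Pm; ring.
by rewrite Pm; field.
Qed.

Lemma card_code_even (B : pred rat) : ~~ odd m ->
  #|[set c in D2 | B (hamming_weight c)%:R]|%:R =
    \sum_(r <- table_even p m) (B r.1)%:R * r.2.
Proof.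
move=> even_m; pose B' z := B (P ^+ m - z).
rewrite card_code_pred (bigD1 0) //= natrD (sum_word_pred_0 B') natr_sum.
(* The nonzero a are split by the size of the radical, p^2 or 1. *)
rewrite (bigID (fun a => #|radical p m l a| == p ^ 2)%N) /=.
have nzP : P != 0 by rewrite pnatr_eq0 -lt0n prime_gt0.
have P1_gt0 : 0 < P + 1 by rewrite -(natrD _ p 1) ltr0n addn1.
pose n2 : rat := #|[set a : F | (a != 0) && (#|radical p m l a| == p ^ 2)%N]|%:R.
have Dn2 : n2 = (P ^+ m - 1) / (P + 1).
  apply: (mulIf (lt0r_neq0 P1_gt0)); rewrite divfK ?gt_eqF //.
  have /(congr1 (fun n => n%:R : rat)) :=
    card_degenerate_even charF oF odd_p l_gt0 even_m co_ml.
  rewrite natrM natrD => ->.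
  by rewrite -natrX -[in RHS](@prednK (p ^ m)) ?expn_gt0 ?prime_gt0 // -natr1 addrK.
set s2 := \sum_(a | _ && (_ == _)) _; set s1 := \sum_(a | _ && (_ != _)) _.
have E2' : P ^+ 2 * s2 = n2 * (P ^+ m *
   ((B' (P ^+ (m - 1) - (-1) ^+ m./2 * (P - 1) * P ^+ m./2))%:R
    + (P - 1) * (B' (P ^+ (m - 1) + (-1) ^+ m./2 * P ^+ m./2))%:R)
  + P ^+ m * (P ^+ 2 - 1) * P * (B' (P ^+ (m - 1)))%:R).
  rewrite /s2 mulr_sumr mulr_natl -sumr_const.
  apply: eq_big => [a|a /andP[nz_a /eqP r2]]; first by rewrite inE.
  have := sum_word_pred_even_p2 charF oF odd_p l_gt0 even_m co_ml B' nz_a r2.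
  by rewrite !natrX.
have E1 : s1 = (P ^+ m - 1 - n2) * (P ^+ m *
   ((B' (P ^+ (m - 1) + (-1) ^+ m./2 * (P - 1) * P ^+ (m./2 - 1)))%:R
    + (P - 1) * (B' (P ^+ (m - 1) - (-1) ^+ m./2 * P ^+ (m./2 - 1)))%:R)).
  have <- : #|(fun a : F => (a != 0) && (#|radical p m l a| != p ^ 2)%N)|%:R
      = P ^+ m - 1 - n2.
    rewrite -card_nz; set n1 := #|_|.
    suff -> : #|(fun a : F => a != 0)| =
        (#|[set a : F | (a != 0%R) && (#|radical p m l a| == p ^ 2)]| + n1)%N.
      by rewrite natrD /n2; ring.
    rewrite -[LHS]sum1_card (bigID (fun a => #|radical p m l a| == p ^ 2)%N) /=.
    rewrite /n1 -!sum1_card; congr (_ + _)%N.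
    by apply: eq_bigl => a; rewrite inE.
  rewrite /s1 mulr_natl -sumr_const; apply: eq_bigr => a /andP[nz_a r2].
  have r1 : #|radical p m l a| = 1%N.
    have [//|/eqP] := card_radical_even charF oF l_gt0 even_m co_ml nz_a.
    by rewrite (negPf r2).
  have := sum_word_pred_even_1 charF oF odd_p l_gt0 even_m co_ml B' nz_a r1.
  by rewrite !natrX.
have E2 : s2 = (P ^+ 2 * s2) / P ^+ 2 by rewrite mulrC mulKf // expf_neq0.
rewrite E2 E2' E1 Dn2 /B' !big_cons big_nil /= subrr subr0.
have -> : P ^+ m - P ^+ (m - 1) = P ^+ (m - 1) * (P - 1) by rewrite Pm; ring.
set s := (-1) ^+ m./2.
have -> : P ^+ m - (P ^+ (m - 1) - s * (P - 1) * P ^+ m./2) =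
  P ^+ (m - 1) * (P - 1) + s * P ^+ m./2 * (P - 1) by rewrite Pm; ring.
have -> : P ^+ m - (P ^+ (m - 1) + s * P ^+ m./2) =
  P ^+ (m - 1) * (P - 1) - s * P ^+ m./2 by rewrite Pm; ring.
have -> : P ^+ m - (P ^+ (m - 1) + s * (P - 1) * P ^+ (m./2 - 1)) =
  P ^+ (m - 1) * (P - 1) - s * P ^+ (m./2 - 1) * (P - 1) by rewrite Pm; ring.
have -> : P ^+ m - (P ^+ (m - 1) - s * P ^+ (m./2 - 1)) =
  P ^+ (m - 1) * (P - 1) + s * P ^+ (m./2 - 1) by rewrite Pm; ring.
(* Writing all frequencies in terms of p and p^(m-2) turns the claim into a rational identity. *)
have -> : P ^+ (m + 1) = P ^+ 3 * P ^+ (m - 2) by rewrite -exprD; congr (_ ^+ _); lia.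
rewrite Pm; have -> : P ^+ (m - 1) = P * P ^+ (m - 2).
  by rewrite -exprS; congr (_ ^+ _); lia.
by field; rewrite nzP lt0r_neq0.
Qed.

End Code.

Theorem theorem3p4 (p m l : nat) (F : finFieldType) (charF : p \in [pchar F])
    (e : 'I_(p ^ m) -> F) :
  prime p -> odd p -> (3 <= m)%N -> (0 < l)%N -> coprime m l ->
  #|F| = (p ^ m)%N -> bijective e ->
  let D2 := code_D2 charF e l in
  let P : rat := p%:R in
  let s : rat := (-1) ^+ m./2 in
  [/\ linear_code_of_dim D2 (2 * m + 1),
      odd m -> has_weight_distribution D2
        [:: (0, 1);
            (P ^+ (m - 1) * (P - 1),
             P * (P ^+ (m - 1) + 1) * (P ^+ m - 1));
            (P ^+ (m - 1) * (P - 1) + P ^+ ((m - 1)./2),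
             1 / 2 * P ^+ m * (P - 1) * (P ^+ m - 1));
            (P ^+ (m - 1) * (P - 1) - P ^+ ((m - 1)./2),
             1 / 2 * P ^+ m * (P - 1) * (P ^+ m - 1));
            (P ^+ m, P - 1)]
    & ~~ odd m -> has_weight_distribution D2
        [:: (0, 1);
            (P ^+ (m - 1) * (P - 1),
             P * (P ^+ (m - 1) - P ^+ (m - 2) + 1) * (P ^+ m - 1));
            (P ^+ (m - 1) * (P - 1) - s * P ^+ (m./2 - 1) * (P - 1),
             P ^+ (m + 1) * (P ^+ m - 1) / (P + 1));
            (P ^+ (m - 1) * (P - 1) + s * P ^+ (m./2 - 1),
             P ^+ (m + 1) * (P - 1) * (P ^+ m - 1) / (P + 1));
            (P ^+ (m - 1) * (P - 1) + s * P ^+ (m./2) * (P - 1),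
             P ^+ (m - 2) * (P ^+ m - 1) / (P + 1));
            (P ^+ (m - 1) * (P - 1) - s * P ^+ (m./2),
             P ^+ (m - 2) * (P - 1) * (P ^+ m - 1) / (P + 1));
            (P ^+ m, P - 1)]].
Proof.
move=> p_pr odd_p m_ge3 l_gt0 co_ml oF bij_e D2 P s; split.
- exact: code_D2_dim.
- move=> odd_m; apply: has_weight_distribution_sum.
    exact: uniq_table_odd.
  by move=> B; apply: card_code_odd.
move=> even_m; apply: has_weight_distribution_sum.
  exact: uniq_table_even.
by move=> B; apply: card_code_even.
Qed.
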